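(* In the frame setting and under standing assumptions (A) of the context, assume $\Sigma\neq0$, let $\Lambda:=1+\|\Sigma^\dagger\|+\|\Gamma\|$, $\varepsilon\in\big(0,\Lambda\sqrt D\min\{1,2\|\Sigma^\dagger\|\}\big)$ and $\delta\in(0,1)$. Define, for $\eta>0$ and $\delta'\in(0,1)$, $\tilde M_{\eta,\delta'}:=\frac{10}{3}KR''\frac{\log(28n/\delta')}{\eta^2}$. If \[ m\ge\max\Big\{\tilde M_{\frac{\varepsilon}{\Lambda\sqrt D},\frac\delta2},\ \tilde M_{\frac{\varepsilon}{4\|\Sigma^\dagger\|^2\Lambda\sqrt D},\frac\delta2}\Big\}, \] then \[ \mathbb P\Big(\big|K_{n,\Omega}-\|W\iota_n\Sigma^\dagger\Gamma\|\big|<\varepsilon\Big)\ge1-\delta,\qquad K_{n,\Omega}:=\|W\iota_n\widehat\Sigma_\Omega^\dagger\widehat\Gamma_\Omega\|. \]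
   Context: Let $\mathcal H$ be a separable complex Hilbert space, $\ell^2=\ell^2(\mathbb N)$ with canonical basis $(e_j)$; $a\otimes b$ denotes $x\mapsto\langle x,b\rangle a$; $\iota_n:\mathbb C^n\to\ell^2$, $\iota_n(x_1,\dots,x_n)=(x_1,\dots,x_n,0,\dots)$; $M^\dagger$ is the Moore–Penrose pseudo-inverse. Frame setting: $(s_k)_{k\in\mathbb N}$ is a frame for its closed span $\mathcal S$; $(w_k)_{k\in\mathbb N}$ is a frame for its closed span $\mathcal W$ with bounds $0<C\le D$ ($C\|w\|^2\le\sum_k|\langle w,w_k\rangle|^2\le D\|w\|^2$, $w\in\mathcal W$). Synthesis operators $Sx=\sum_kx_ks_k$, $Wx=\sum_kx_kw_k$; $U:=S^*W$. Fix $n$, $\mathcal W_n:=\operatorname{span}\{w_1,\dots,w_n\}$, $P_{\mathcal W_n^\perp}$ orthogonal projection onto $\mathcal W_n^\perp$. $\Sigma:=\iota_n^*U^*U\iota_n$, $v_j:=\iota_n^*U^*e_j$, $u_j:=P_{\mathcal W_n^\perp}s_j$, $\Gamma:=\iota_n^*U^*S^*P_{\mathcal W_n^\perp}$. $p$ a probability distribution on $\mathbb N$, $\operatorname{supp}(p)=\{j:p_j>0\}$, $R:=\sup_{j\in\operatorname{supp}(p)}\|v_j\|^2/p_j$, $R':=\sup_{j\in\operatorname{supp}(p)}\|u_j\|^2/p_j$, $R'':=\max\{R,R'\}$, $T:=\sum_{j\in\operatorname{supp}(p)}u_j\otimes u_j$, $K:=\max\{\|\Sigma\|,\|T\|\}$.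 $i_1,\dots,i_m$ i.i.d. with law $p$, $Q_\Omega:=\frac1m\sum_t\frac{e_{i_t}\otimes e_{i_t}}{p_{i_t}}$, $\widehat\Sigma_\Omega:=\iota_n^*U^*Q_\Omega U\iota_n$, $\widehat\Gamma_\Omega:=\iota_n^*U^*Q_\Omega S^*P_{\mathcal W_n^\perp}$. Standing assumptions (A): (i) $\mathcal W\cap\mathcal S^\perp=\{0\}$; (ii) $R<\infty$, $R'<\infty$; (iii) $p_j>0$ whenever $v_j\neq0$. *)

(* Defs.v *)
From HB Require Import structures.
From mathcomp Require Import all_boot all_order all_algebra.
From mathcomp Require Import complex.
From mathcomp Require Import all_classical all_reals.
From mathcomp Require Import all_analysis.

Set Implicit Arguments.
Unset Strict Implicit.
Unset Printing Implicit Defensive.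

Import Order.TTheory GRing.Theory Num.Theory.
Import numFieldNormedType.Exports.
Local Open Scope classical_set_scope.
Local Open Scope ring_scope.

Definition cnorm2 {R : realType} (z : R[i]) : R :=
  complex.Re z ^+ 2 + complex.Im z ^+ 2.
Definition cabs {R : realType} (z : R[i]) : R := Num.sqrt (cnorm2 z).

Definition vnorm {R : realType} {n : nat} (v : 'cV[R[i]]_n) : R :=
  Num.sqrt (\sum_(k < n) cnorm2 (v k 0)).

Definition opnorm {R : realType} {X Y : Type} (nx : X -> R) (ny : Y -> R)
  (f : X -> Y) : R :=
  sup [set r | exists x, nx x <= 1 /\ r = ny (f x)].

Definition mxnorm {R : realType} {n : nat} (A : 'M[R[i]]_n) : R :=
  opnorm (@vnorm R n) (@vnorm R n) (fun v => A *m v).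

Definition ctr {R : realType} {n : nat} (A : 'M[R[i]]_n) : 'M[R[i]]_n :=
  map_mx (@conjc R) A^T.
Definition is_pinv {R : realType} {n : nat} (A X : 'M[R[i]]_n) : Prop :=
  [/\ A *m X *m A = A, X *m A *m X = X,
      ctr (A *m X) = A *m X & ctr (X *m A) = X *m A].
Definition mppinv {R : realType} {n : nat} (A : 'M[R[i]]_n) : 'M[R[i]]_n :=
  xget 0 [set X | is_pinv A X].

Definition series_lim {R : realType} {T : zmodType} (nrm : T -> R)
  (f : nat -> T) : T :=
  xget 0 [set y | (fun N => nrm (\sum_(j < N) f j - y)) @ \oo --> (0 : R)].

Definition l2ip {R : realType} (a b : nat -> R[i]) : R[i] :=
  series_lim (@cabs R) (fun j => a j * conjc (b j)).

Section Hilbert.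
Variables (R : realType) (V : lmodType R[i]) (ip : V -> V -> R[i]).

Definition is_inner_product : Prop :=
  [/\ forall (a : R[i]) (x y z : V), ip (a *: x + y) z = a * ip x z + ip y z,
      forall x y, ip y x = conjc (ip x y),
      forall x, 0 <= complex.Re (ip x x)
    & forall x, ip x x = 0 -> x = 0].

Definition hnorm (x : V) : R := Num.sqrt (complex.Re (ip x x)).

Definition hcomplete : Prop :=
  forall u : nat -> V,
    (forall e : R, 0 < e -> exists N, forall a b, (N <= a)%N -> (N <= b)%N ->
        hnorm (u a - u b) < e) ->
    exists y, (fun k => hnorm (u k - y)) @ \oo --> (0 : R).

Definition hseparable : Prop :=
  exists d : nat -> V, forall (x : V) (e : R), 0 < e -> exists k, hnorm (x - d k) < e.

Definition is_hilbert : Prop := [/\ is_inner_product, hcomplete & hseparable].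

Definition cspan (f : nat -> V) : set V :=
  [set x | forall e : R, 0 < e -> exists N (c : nat -> R[i]),
      hnorm (x - \sum_(k < N) c k *: f k) < e].

Definition frame_bounds (f : nat -> V) (A B : R) : Prop :=
  [/\ 0 < A, A <= B &
    forall x, cspan f x ->
      ((A * hnorm x ^+ 2)%:E <= \sum_(k <oo) (cnorm2 (ip x (f k)))%:E)%E /\
      (\sum_(k <oo) (cnorm2 (ip x (f k)))%:E <= (B * hnorm x ^+ 2)%:E)%E].

Definition is_frame (f : nat -> V) : Prop := exists A B, frame_bounds f A B.

End Hilbert.

Section FrameSetting.
Variables (R : realType) (V : lmodType R[i]) (ip : V -> V -> R[i]).
Variables (s w : nat -> V) (n : nat) (p : nat -> R).

(* U e_l = S^* W e_l = S^* w_l = (<w_l, s_j>)_j *)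
Definition Ue (l : nat) : nat -> R[i] := fun j => ip (w l) (s j).

(* Sigma = iota_n^* U^* U iota_n, entries <U e_l, U e_k>_{l^2} *)
Definition Sigma : 'M[R[i]]_n := \matrix_(k < n, l < n) l2ip (Ue l) (Ue k).

(* v_j = iota_n^* U^* e_j = (<s_j, w_k>)_{k<n} *)
Definition vvec (j : nat) : 'cV[R[i]]_n := \col_(k < n) ip (s j) (w k).

Definition projWnperp (x : V) : V :=
  xget 0 [set y | (forall k : 'I_n, ip y (w k) = 0) /\
                  exists c : 'I_n -> R[i], x - y = \sum_(k < n) c k *: w k].

Definition uvec (j : nat) : V := projWnperp (s j).

(* Gamma = iota_n^* U^* S^* P_{W_n^perp} : (Gamma x)_k = <S^* P x, U e_k>_{l^2} *)
Definition Gamma (x : V) : 'cV[R[i]]_n :=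
  \col_(k < n) l2ip (fun j => ip (projWnperp x) (s j)) (Ue k).

Definition Rcst : R :=
  sup [set r | exists j, 0 < p j /\ r = vnorm (vvec j) ^+ 2 / p j].
Definition Rcst' : R :=
  sup [set r | exists j, 0 < p j /\ r = hnorm ip (uvec j) ^+ 2 / p j].
Definition Rcst'' : R := Num.max Rcst Rcst'.

Definition Top (x : V) : V :=
  series_lim (hnorm ip)
    (fun j => if 0 < p j then ip x (uvec j) *: uvec j else 0).

Definition Kcst : R := Num.max (mxnorm Sigma) (opnorm (hnorm ip) (hnorm ip) Top).

Variable (m : nat).

(* <Q_Omega a, b>_{l^2} with Q_Omega = 1/m sum_t (e_{i_t} (x) e_{i_t}) / p_{i_t} *)
Definition qip (i : {ffun 'I_m -> nat}) (a b : nat -> R[i]) : R[i] :=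
  (m%:R)^-1 * \sum_(t < m) ((p (i t))^-1)%:C%C * a (i t) * conjc (b (i t)).

Definition Sigma_hat (i : {ffun 'I_m -> nat}) : 'M[R[i]]_n :=
  \matrix_(k < n, l < n) qip i (Ue l) (Ue k).

Definition Gamma_hat (i : {ffun 'I_m -> nat}) (x : V) : 'cV[R[i]]_n :=
  \col_(k < n) qip i (fun j => ip (projWnperp x) (s j)) (Ue k).

Definition Wn (c : 'cV[R[i]]_n) : V := \sum_(k < n) c k 0 *: w k.

Definition Ktrue : R :=
  opnorm (hnorm ip) (hnorm ip) (fun x => Wn (mppinv Sigma *m Gamma x)).
Definition K_Omega (i : {ffun 'I_m -> nat}) : R :=
  opnorm (hnorm ip) (hnorm ip) (fun x => Wn (mppinv (Sigma_hat i) *m Gamma_hat i x)).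

End FrameSetting.

Definition iid_prob {R : realType} (p : nat -> R) (m : nat)
  (E : set {ffun 'I_m -> nat}) : \bar R :=
  (\esum_(i in E) (\prod_(t < m) p (i t))%:E)%E.

Definition Mtilde {R : realType} (K R'' : R) (n : nat) (eta dl : R) : R :=
  10%:R / 3%:R * K * R'' * ln (28%:R * n%:R / dl) / eta ^+ 2.

(* Main.v *)
(* Both empirical operators are averages of m independent rank-one operators
   (v_j (x) u_j) / p_j, with u_j = v_j for Sigma, so a single Bernstein bound
   with failure probability at most delta/4 at tolerance
   eta = min(eta1, eta2), where eta1 = eps / (Lambda sqrt D) and
   eta2 = eta1 / (4 |Sigma^+|^2), serves for both; since |Sigma^+| K >= 1, this
   eta is at most K/2.

   The Bernstein bound avoids Golden-Thompson and Lieb: writing traces as double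
   sums over the eigenbases of A and A + X, scalar inequalities give
   tr exp(A + X) <= tr exp A + tr (X exp A) + (2/3) tr (X^2 exp A) whenever
   |X| <= 1/2. Iterating this for tr (cosh - 1) of Hermitian dilations, whose
   variance has trace at most 2 n times the bound on its norm, yields a
   dimension factor proportional to n only. Truncating to finitely many indices
   j < N and representing u_0, ..., u_(N-1) through a square root of their Gram
   matrix makes everything finite-dimensional; the truncation error is at most
   R'' (1 - p_0 - ... - p_(N-1)).

   Finally every v_j lies in the range of Sigma, so the range of the empirical
   Sigma is contained in that of Sigma, and the two ranges agree when the error
   is below 1 / |Sigma^+|; the pseudo-inverses are then compared by the resolvent
   identity. *)
Require Import Defs.
From HB Require Import structures.
From mathcomp Require Import all_boot all_order all_algebra.
From mathcomp Require Import complex ring lra.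
From mathcomp Require Import all_classical all_reals all_analysis.

Import Order.TTheory GRing.Theory Num.Theory.
Import numFieldNormedType.Exports.
Local Open Scope classical_set_scope.
Local Open Scope ring_scope.

(** * Scalar inequalities for the exponential *)

(** The obstacle is that the dilations live in dimension n + N, with N growing as the truncation is
    refined, while the factor must involve n alone. Iterating tr exp would start from its value at
    0, the full dimension. The function cosh - 1 vanishes at 0, so only the trace of the variance
    enters, and this is controlled by the n coordinates of the v_j.

    Constants: with th = eta / (2 R'' K) and y0 = m eta^2 / (2 R'' K), the moment bound costs 4 n
    exp(y0 / 3) against a gain of about exp y0. The factor 10/3 makes y0 at least 5/3 log(28 n /
    dl), more than the 3/2 log(28 n / dl) that is used; the 28 absorbs the 4, the - 2 of 2 cosh - 2,
    and a factor exp(-1/3) lost to truncation.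

    Besides the two events of probability delta/4, the remaining delta/2 pays for the samples with
    some index at least N.

    Write a, g for the norms of the pseudo-inverse of Sigma and of Gamma. The final error is at most
    sqrt D eta1 (a + eta1 / 2 + g / 2), and eta1 < 1 puts it below sqrt D eta1 (1 + a + g) = eps. *)

Lemma nonneg_of_derive {R : realType} (f df : R -> R) :
  (forall x : R, is_derive x 1 f (df x)) -> f 0 = 0 ->
  (forall x, 0 <= x -> 0 <= df x) -> forall x, 0 <= x -> 0 <= f x.
Proof.
move=> fd f0 df0 x; rewrite le_eqVlt => /predU1P[<-|x0]; first by rewrite f0.
have cf : {within `[0, x], continuous f}.
  apply: derivable_within_continuous => z _.
  by have := fd z; case.
have [c /[!in_itv]/= /andP[c0 cx] E] := MVT x0 (fun z _ => fd z) cf.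
by rewrite f0 !subr0 in E; rewrite E mulr_ge0 ?df0// ltW.
Qed.

(** Taylor's formula with integral remainder, where exp(s x) is bounded by its chord (1 - s) + s exp
    x: the weights 1/3 and 1/6 are the integrals of (1 - s)^2 and s (1 - s) over [0, 1]. The proof
    multiplies by exp(-x) and differentiates, separately for the two signs of x. *)
Lemma expR_le_quadratic {R : realType} (x : R) :
  expR x <= 1 + x + x ^+ 2 / 3 + x ^+ 2 * expR x / 6.
Proof.
have pos (t : R) : 0 <= t -> 0 <= 1 + t + t ^+ 2 / 3 + (t ^+ 2 / 6 - 1) * expR t.
  move=> t0.
  have h u : 0 <= u -> 0 <= (1 + u + u ^+ 2 / 3) * expR (- u) + u ^+ 2 / 6 - 1 :> R.
    apply: (@nonneg_of_derive _
      (fun u => (1 + u + u ^+ 2 / 3) * expR (- u) + u ^+ 2 / 6 - 1)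
      (fun u => (u / 3) * (1 - expR (- u) * (1 + u)))) => [v||v v0].
    - apply: is_derive_eq; rewrite /GRing.scale/=.
      by field.
    - by rewrite oppr0 expR0; field.
    - rewrite mulr_ge0 ?divr_ge0// subr_ge0 expRN mulrC ler_pdivrMr ?expR_gt0//.
      by rewrite mul1r expR_ge1Dx.
  have := mulr_ge0 (expR_ge0 t) (h t t0).
  suff -> : expR t * ((1 + t + t ^+ 2 / 3) * expR (- t) + t ^+ 2 / 6 - 1)
     = 1 + t + t ^+ 2 / 3 + (t ^+ 2 / 6 - 1) * expR t by [].
  have e1 : expR t * expR (- t) = 1 by rewrite -expRD subrr expR0.
  have -> : expR t * ((1 + t + t ^+ 2 / 3) * expR (- t) + t ^+ 2 / 6 - 1) =
     (expR t * expR (- t)) * (1 + t + t ^+ 2 / 3) + expR t * (t ^+ 2 / 6 - 1) by ring.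
  by rewrite e1; ring.
have neg (t : R) : 0 <= t -> 0 <= 1 - t + t ^+ 2 / 3 + (t ^+ 2 / 6 - 1) * expR (- t).
  move=> t0.
  have h u : 0 <= u -> 0 <= (1 - u + u ^+ 2 / 3) * expR u + u ^+ 2 / 6 - 1 :> R.
    apply: (@nonneg_of_derive _
      (fun u => (1 - u + u ^+ 2 / 3) * expR u + u ^+ 2 / 6 - 1)
      (fun u => (u / 3) * (1 - expR u * (1 - u)))) => [v||v v0].
    - apply: is_derive_eq; rewrite /GRing.scale/=.
      by field.
    - by rewrite expR0; field.
    - rewrite mulr_ge0 ?divr_ge0// subr_ge0.
      have := expR_ge1Dx (- v); rewrite expRN => H.
      have := ler_wpM2l (expR_ge0 v) H.
      by rewrite mulfV ?gt_eqF ?expR_gt0.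
  have := mulr_ge0 (expR_ge0 (- t)) (h t t0).
  have e1 : expR t * expR (- t) = 1 by rewrite -expRD subrr expR0.
  have -> : expR (- t) * ((1 - t + t ^+ 2 / 3) * expR t + t ^+ 2 / 6 - 1) =
     (expR t * expR (- t)) * (1 - t + t ^+ 2 / 3) + expR (- t) * (t ^+ 2 / 6 - 1) by ring.
  rewrite e1 => H; apply: le_trans H _; rewrite le_eqVlt; apply/orP; left.
  by apply/eqP; ring.
case: (leP 0 x) => x0.
  by have := pos x x0; lra.
have xx : 0 <= - x by rewrite oppr_ge0 ltW.
by have := neg _ xx; rewrite opprK sqrrN; lra.
Qed.

(** The slope of a chord of exp is the mean of exp over the interval, which by convexity is at most
    the mean of the end values. The product form of the last equation covers a = b, where d = 0
    serves. *)
Lemma expR_divided_difference {R : realType} (a b : R) :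
  exists d, [/\ 0 <= d, d <= (expR a + expR b) / 2 & expR b - expR a = d * (b - a)].
Proof.
have h u : 0 <= u -> 0 <= u / 2 * (1 + expR u) - expR u + 1 :> R.
  apply: (@nonneg_of_derive _
      (fun u => u / 2 * (1 + expR u) - expR u + 1)
      (fun u => (1 - expR u * (1 - u)) / 2)) => [v||v v0].
  - apply: is_derive_eq; rewrite /GRing.scale/=.
    by field.
  - by rewrite expR0; field.
  - rewrite divr_ge0// subr_ge0.
    have := expR_ge1Dx (- v); rewrite expRN => H.
    have := ler_wpM2l (expR_ge0 v) H.
    by rewrite mulfV ?gt_eqF ?expR_gt0.
have [<-|ab] := eqVneq a b.
  by exists 0; split; rewrite ?divr_ge0 ?addr_ge0 ?expR_ge0 ?subrr ?mulr0.
have main (x y : R) : x < y -> 0 <= (expR y - expR x) / (y - x) <= (expR x + expR y) / 2.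
  move=> xy; have yx : 0 < y - x by rewrite subr_gt0.
  apply/andP; split; first by apply: divr_ge0; rewrite subr_ge0 ?ler_expR ltW.
  rewrite ler_pdivrMr//; have := h _ (ltW yx).
  have Ey : expR y = expR x * expR (y - x) by rewrite -expRD addrC subrK.
  rewrite Ey => H; have := mulr_ge0 (expR_ge0 x) H; lra.
exists ((expR b - expR a) / (b - a)).
have E : (expR b - expR a) / (b - a) * (b - a) = expR b - expR a.
  by rewrite mulfVK // subr_eq0 eq_sym.
case: (ltgtP a b) => [/main/andP[]//|/main/andP[H1 H2]|abE]; last by rewrite abE eqxx in ab.
rewrite E -(opprB (expR a)) -(opprB a) invrN mulrNN; split => //.
by rewrite [expR a + _]addrC.
Qed.

(** * Adjoints, Frobenius norms and spectral decompositions *)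

Section Complex.
Context {R : realType}.
Implicit Types z w : R[i].

Lemma cnorm2_ge0 z : 0 <= cnorm2 z.
Proof. by rewrite addr_ge0 ?sqr_ge0. Qed.

Lemma cnorm2M z w : cnorm2 (z * w) = cnorm2 z * cnorm2 w.
Proof. by case: z w => a b [c d]; rewrite /cnorm2 /=; ring. Qed.

Lemma cnorm2_conj z : cnorm2 (conjc z) = cnorm2 z.
Proof. by case: z => a b; rewrite /cnorm2 /= sqrrN. Qed.

Lemma cnorm2N z : cnorm2 (- z) = cnorm2 z.
Proof. by case: z => a b; rewrite /cnorm2 /= !sqrrN. Qed.

Lemma cnorm2_real (x : R) : cnorm2 x%:C%C = x ^+ 2.
Proof. by rewrite /cnorm2 /= expr0n addr0. Qed.

Lemma cnorm20 : cnorm2 (0 : R[i]) = 0.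
Proof. by rewrite /cnorm2 /= expr0n addr0. Qed.

Lemma cnorm2_eq0 z : cnorm2 z = 0 -> z = 0.
Proof.
case: z => a b; rewrite /cnorm2 /= => /eqP.
by rewrite paddr_eq0 ?sqr_ge0// !sqrf_eq0 => /andP[/eqP-> /eqP->].
Qed.

Lemma mul_conjc z : z * conjc z = (cnorm2 z)%:C%C.
Proof. by rewrite -sqr_normc sqr_normc; case: z => a b; rewrite /cnorm2 /=; apply/eqP; rewrite eq_complex /=; apply/andP; split; apply/eqP; ring. Qed.

Lemma conjcM z w : conjc (z * w) = conjc z * conjc w.
Proof. exact: rmorphM. Qed.

Lemma conjcD z w : conjc (z + w) = conjc z + conjc w.
Proof. exact: rmorphD. Qed.

Lemma ReD z w : complex.Re (z + w) = complex.Re z + complex.Re w.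
Proof. by case: z w => a b [c d]. Qed.

Lemma ImD z w : complex.Im (z + w) = complex.Im z + complex.Im w.
Proof. by case: z w => a b [c d]. Qed.

Lemma Re_sum (I : Type) (r : seq I) (P : pred I) (F : I -> R[i]) :
  complex.Re (\sum_(i <- r | P i) F i) = \sum_(i <- r | P i) complex.Re (F i).
Proof. by apply: (big_morph _ ReD). Qed.

Lemma Im_sum (I : Type) (r : seq I) (P : pred I) (F : I -> R[i]) :
  complex.Im (\sum_(i <- r | P i) F i) = \sum_(i <- r | P i) complex.Im (F i).
Proof. by apply: (big_morph _ ImD). Qed.

Lemma ReZ (x : R) z : complex.Re (x%:C%C * z) = x * complex.Re z.
Proof. by case: z => a b /=; rewrite mul0r subr0. Qed.

Lemma conjc_sum (I : Type) (r : seq I) (P : pred I) (F : I -> R[i]) :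
  conjc (\sum_(i <- r | P i) F i) = \sum_(i <- r | P i) conjc (F i).
Proof. exact: rmorph_sum. Qed.

Lemma rcM (x y : R) : ((x * y)%:C = x%:C * y%:C :> R[i])%C.
Proof. exact: rmorphM. Qed.

Lemma rc_sum (I : Type) (r : seq I) (P : pred I) (F : I -> R) :
  (\sum_(i <- r | P i) F i)%:C%C = \sum_(i <- r | P i) (F i)%:C%C.
Proof. exact: rmorph_sum. Qed.

End Complex.

Section Adjoint.
Local Open Scope sesquilinear_scope.
Context {R : realType}.
Notation C := R[i].

(** Rectangular form of [ctr], convertible with it on square matrices, so that the equations in
    [is_pinv] apply directly. *)
Definition adj {m n} (A : 'M[C]_(m, n)) : 'M[C]_(n, m) := map_mx (@conjc R) A^T.

(** The squared Frobenius norm; on a row or a column it is the squared Euclidean norm. Operator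
    bounds are written as fro (y A) <= L fro y for all rows y, so [L] bounds a squared operator
    norm. *)
Definition fro {m n} (A : 'M[C]_(m, n)) : R := \sum_i \sum_j cnorm2 (A i j).

Lemma adjE {m n} (A : 'M[C]_(m, n)) i j : adj A i j = conjc (A j i).
Proof. by rewrite !mxE. Qed.

Lemma adjK {m n} (A : 'M[C]_(m, n)) : adj (adj A) = A.
Proof. by apply/matrixP => i j; rewrite !mxE conjcK. Qed.

Lemma adjM {m n p} (A : 'M[C]_(m, n)) (B : 'M[C]_(n, p)) :
  adj (A *m B) = adj B *m adj A.
Proof. by rewrite /adj trmx_mul map_mxM. Qed.

Lemma adjD {m n} (A B : 'M[C]_(m, n)) : adj (A + B) = adj A + adj B.
Proof. by rewrite /adj linearD map_mxD. Qed.

Lemma adjN {m n} (A : 'M[C]_(m, n)) : adj (- A) = - adj A.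
Proof. by rewrite /adj linearN map_mxN. Qed.

Lemma adj0 {m n} : adj (0 : 'M[C]_(m, n)) = 0.
Proof. by rewrite /adj trmx0 map_mx0. Qed.

Lemma adj_rZ {m n} (x : R) (A : 'M[C]_(m, n)) : adj (x%:C%C *: A) = x%:C%C *: adj A.
Proof. by apply/matrixP => i j; rewrite !mxE conjcM conjc_real. Qed.

Lemma adj_sum {m n} (I : Type) (r : seq I) (P : pred I) (F : I -> 'M[C]_(m, n)) :
  adj (\sum_(i <- r | P i) F i) = \sum_(i <- r | P i) adj (F i).
Proof. by apply: (big_morph adj adjD adj0). Qed.

Lemma fro_ge0 {m n} (A : 'M[C]_(m, n)) : 0 <= fro A.
Proof. by do 2! (apply: sumr_ge0 => ? _); apply: cnorm2_ge0. Qed.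

Lemma froE {m n} (A : 'M[C]_(m, n)) : (fro A)%:C%C = \tr (A *m adj A).
Proof.
rewrite /fro rc_sum; apply: eq_bigr => i _; rewrite rc_sum mxE.
by apply: eq_bigr => j _; rewrite adjE mul_conjc.
Qed.

Lemma fro0 {m n} : fro (0 : 'M[C]_(m, n)) = 0.
Proof. by rewrite /fro big1// => i _; rewrite big1// => j _; rewrite mxE cnorm20. Qed.

Lemma fro_eq0 {m n} (A : 'M[C]_(m, n)) : fro A = 0 -> A = 0.
Proof.
move=> A0; apply/matrixP => i j; rewrite mxE; apply: cnorm2_eq0.
move/eqP: A0; rewrite psumr_eq0 => [/allP/(_ i)|k _]; last first.
  by apply: sumr_ge0 => l _; apply: cnorm2_ge0.
rewrite mem_index_enum => /(_ isT)/implyP/(_ isT).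
rewrite psumr_eq0 => [/allP/(_ j)|l _]; last exact: cnorm2_ge0.
by rewrite mem_index_enum => /(_ isT)/implyP/(_ isT)/eqP.
Qed.

Lemma fro_adj {m n} (A : 'M[C]_(m, n)) : fro (adj A) = fro A.
Proof.
rewrite /fro exchange_big; apply: eq_bigr => i _; apply: eq_bigr => j _.
by rewrite adjE cnorm2_conj.
Qed.

Lemma froN {m n} (A : 'M[C]_(m, n)) : fro (- A) = fro A.
Proof. by do 2! (apply: eq_bigr => ? _); rewrite mxE cnorm2N. Qed.

Lemma froZ {m n} (c : C) (A : 'M[C]_(m, n)) : fro (c *: A) = cnorm2 c * fro A.
Proof.
rewrite /fro mulr_sumr; apply: eq_bigr => i _; rewrite mulr_sumr.
by apply: eq_bigr => j _; rewrite mxE cnorm2M.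
Qed.

Lemma fro_row {m n} (A : 'M[C]_(m, n)) : fro A = \sum_i fro (row i A).
Proof.
apply: eq_bigr => i _; rewrite /fro big_ord1; apply: eq_bigr => j _.
by rewrite mxE.
Qed.

Lemma fro_rowE {m n} (A : 'M[C]_(m, n)) i : fro (row i A) = \sum_j cnorm2 (A i j).
Proof. by rewrite /fro big_ord1; apply: eq_bigr => j _; rewrite mxE. Qed.

Lemma fro_mulUr {m n p} (A : 'M[C]_(m, n)) (Q : 'M[C]_(n, p)) :
  Q *m adj Q = 1%:M -> fro (A *m Q) = fro A.
Proof.
move=> QQ; apply: (@complexI R); rewrite !froE adjM mulmxA -(mulmxA A).
by rewrite QQ mulmx1.
Qed.

Lemma fro_mulUl {m n p} (A : 'M[C]_(m, n)) (Q : 'M[C]_(p, m)) :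
  adj Q *m Q = 1%:M -> fro (Q *m A) = fro A.
Proof.
by move=> QQ; rewrite -fro_adj adjM fro_mulUr ?fro_adj// adjK.
Qed.

Lemma adj_map_diag {n} (a : 'I_n -> R) :
  adj (diag_mx (\row_j (a j)%:C%C)) = diag_mx (\row_j (a j)%:C%C).
Proof.
apply/matrixP => i j; rewrite adjE !mxE eq_sym.
by case: eqVneq => [->|_]; rewrite ?mulr1n ?mulr0n ?conjc_real ?conjc0.
Qed.

(** The rows of [P] are orthonormal left eigenvectors, P A = diag(a) P, which suits estimates stated
    for row vectors. *)
Definition eigd {n} (A P : 'M[C]_n) (a : 'I_n -> R) : Prop :=
  [/\ P *m adj P = 1%:M, adj P *m P = 1%:M &
      A = adj P *m diag_mx (\row_j (a j)%:C%C) *m P].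

Definition eigval {n} (A : 'M[C]_n) (j : 'I_n) : R := complex.Re (spectral_diag A 0 j).

Lemma eigd_spectral {n} (A : 'M[C]_n) :
  adj A = A -> eigd A (spectralmx A) (eigval A).
Proof.
move=> hA; have hH : A \is hermsymmx.
  by apply/is_hermitianmxP; rewrite expr0 scale1r; exact: (esym hA).
have /orthomx_spectralP := hermitian_normalmx hH.
have := hermitian_spectral_diag_real hH.
have := spectral_unitarymx A; rewrite /eigval.
move: (spectralmx A) (spectral_diag A) => P d U dR.
rewrite (invmx_unitary U) => E.
have EP : P^t* = adj P by apply/matrixP => i j; rewrite !mxE.
have PP : P *m adj P = 1%:M by rewrite -EP; apply/unitarymxP.
split; first exact: PP.
  exact: (mulmx1C PP).
suff -> : \row_j (complex.Re (d 0 j))%:C%C = d by rewrite -EP.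
apply/rowP => j; rewrite mxE RRe_real //.
by move/mxOverP : dR; apply.
Qed.

Lemma eigdN {n} {A P : 'M[C]_n} {a} : eigd A P a -> eigd (- A) P (fun j => - a j).
Proof.
move=> [P1 P2 ->]; split => //; rewrite -mulNmx -mulmxN; congr (_ *m _ *m _).
apply/matrixP => i j; rewrite !mxE.
by case: eqVneq => _; rewrite ?mulr1n ?mulr0n ?oppr0 //= rmorphN.
Qed.

End Adjoint.

(** * Trace inequality and matrix Bernstein bound *)

Section TraceExp.
Context {R : realType} {D : nat}.
Notation C := R[i].

Lemma sum_cnorm2_row {m n} (A : 'M[C]_(m, n)) i :
  \sum_j cnorm2 (A i j) = complex.Re ((A *m adj A) i i).
Proof.
rewrite mxE Re_sum; apply: eq_bigr => j _.
by rewrite adjE mul_conjc.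
Qed.

(* Expanding everything in the eigenbases of [A] and of [A + X], with overlap
   matrix [S], turns traces of products into double sums, because the entries
   of [X] between the two bases are [(b j - a i) * S i j]. The third-order
   error is controlled by comparing [tr (X^2 exp (A + X))] with
   [tr (X^2 exp A)] through divided differences. *)
Lemma trace_exp_perturbation {A X P Q : 'M[C]_D} {a b : 'I_D -> R} :
  eigd A P a -> eigd (A + X) Q b -> adj X = X ->
  (forall y : 'rV_D, fro (y *m X) <= fro y / 4) ->
  \sum_j expR (b j) <= \sum_i expR (a i) *
    (1 + complex.Re ((P *m X *m adj P) i i) + 2 / 3 * fro (row i P *m X)).
Proof.
move=> [P1 P2 EA] [Q1 Q2 EB] hX Xn.
pose S := P *m adj Q; pose x := P *m X *m adj Q; pose y := P *m X *m X *m adj Q.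
have adjS : adj S = Q *m adj P by rewrite adjM adjK.
have adjx : adj x = Q *m X *m adj P by rewrite !adjM adjK hX mulmxA.
have adjy : adj y = Q *m X *m X *m adj P by rewrite !adjM adjK hX !mulmxA.
have adjQQ m (Z : 'M[C]_(m, D)) : Z *m adj Q *m Q = Z by rewrite -mulmxA Q2 mulmx1.
have adjPP m (Z : 'M[C]_(m, D)) : Z *m adj P *m P = Z by rewrite -mulmxA P2 mulmx1.
have QQ m (Z : 'M[C]_(m, D)) : Z *m Q *m adj Q = Z by rewrite -mulmxA Q1 mulmx1.
have xE i j : x i j = (b j - a i)%:C%C * S i j.
  have : x = P *m (A + X) *m adj Q - P *m A *m adj Q.
    by rewrite -mulmxBl -mulmxBr addrAC subrr add0r.
  rewrite EB EA !mulmxA QQ P1 mul1mx => ->.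
  rewrite -/S -mulmxA -/S mul_mx_diag mul_diag_mx !mxE.
  by rewrite rmorphB /= mulrBl mulrC.
pose W i j := cnorm2 (S i j); pose N i j := cnorm2 (x i j).
pose M i j := cnorm2 (y i j); pose r i j := complex.Re (y i j * conjc (S i j)).
have NE i j : N i j = (b j - a i) ^+ 2 * W i j by rewrite /N xE cnorm2M cnorm2_real.
have W0 i j : 0 <= W i j by apply: cnorm2_ge0.
have rowW i : \sum_j W i j = 1.
  by rewrite sum_cnorm2_row adjS /S mulmxA adjQQ P1 mxE eqxx.
have colW j : \sum_i W i j = 1.
  under eq_bigr do rewrite /W -cnorm2_conj -adjE.
  by rewrite sum_cnorm2_row adjK adjS mulmxA adjPP Q1 mxE eqxx.
have rowN i : fro (row i P *m X) = \sum_j N i j.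
  by rewrite -row_mul -(@fro_mulUr _ _ _ _ (row i (P *m X)) (adj Q)) ?adjK// -row_mul fro_rowE.
have linE i : complex.Re ((P *m X *m adj P) i i) = \sum_j (b j - a i) * W i j.
  have -> : P *m X *m adj P = x *m adj S by rewrite adjS mulmxA adjQQ.
  rewrite mxE Re_sum; apply: eq_bigr => j _.
  by rewrite adjE xE -mulrA ReZ mul_conjc.
(* Both row sums are diagonal entries of P X^2 (adj P); in [rcol] both column sums are diagonal
   entries of Q X^2 (adj Q). Hence [N] can be traded for [r] against either family of
   exponentials. *)
have rrow i : \sum_j N i j = \sum_j r i j.
  rewrite sum_cnorm2_row -Re_sum; congr complex.Re.
  rewrite adjx /x !mulmxA adjQQ.
  have -> : P *m X *m X *m adj P = y *m adj S by rewrite adjS mulmxA adjQQ.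
  by rewrite mxE; apply: eq_bigr => j _; rewrite adjE.
have rcol j : \sum_i N i j = \sum_i r i j.
  under eq_bigr do rewrite /N -cnorm2_conj -adjE.
  rewrite sum_cnorm2_row -Re_sum; congr complex.Re.
  rewrite adjK adjx /x !mulmxA adjPP.
  have -> : Q *m X *m X *m adj Q = adj S *m y by rewrite adjS /y !mulmxA adjPP.
  by rewrite mxE; apply: eq_bigr => i _; rewrite adjE mulrC.
have rowM i : \sum_j M i j <= (\sum_j N i j) / 4.
  rewrite -rowN -fro_rowE /y 3!row_mul fro_mulUr ?adjK//.
have colM j : \sum_i M i j <= (\sum_i N i j) / 4.
  under eq_bigr do rewrite /M -cnorm2_conj -adjE.
  under [X in _ <= X / _]eq_bigr do rewrite /N -cnorm2_conj -adjE.
  rewrite -!fro_rowE adjy adjx (row_mul j _ (adj P)) (row_mul j (Q *m X) (adj P)).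
  by rewrite !fro_mulUr ?adjK// row_mul.
pose ea i := expR (a i); pose eb j := expR (b j).
have ea0 i : 0 <= ea i by exact: expR_ge0.
have eb0 i : 0 <= eb i by exact: expR_ge0.
pose psA := \sum_i ea i * \sum_j N i j; pose psB := \sum_j eb j * \sum_i N i j.
have dist (f : 'I_D -> R) (G : 'I_D -> 'I_D -> R) :
    \sum_i f i * \sum_j G i j = \sum_i \sum_j f i * G i j.
  by apply: eq_bigr => i _; rewrite mulr_sumr.
have distc (f : 'I_D -> R) (G : 'I_D -> 'I_D -> R) :
    \sum_j f j * \sum_i G i j = \sum_i \sum_j f j * G i j.
  by rewrite [RHS]exchange_big; apply: eq_bigr => i _; rewrite mulr_sumr.
(* The factor b_j - a_i produced by the divided difference turns S_ij into x_ij, and the real part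
   of y_ij times the conjugate of x_ij is at most N_ij / 4 + M_ij by completing squares. *)
have key i j : (eb j - ea i) * r i j <= (ea i + eb j) / 2 * (N i j / 4 + M i j).
  have [d [d0 dle ->]] := expR_divided_difference (a i) (b j).
  have : (b j - a i) * r i j <= N i j / 4 + M i j.
    rewrite NE /W /r /M; move: (y i j) (S i j) (b j - a i) => [y1 y2] [s1 s2] t.
    rewrite /cnorm2 /=.
    rewrite -subr_ge0; rewrite (_ : _ - _ =
      (t * s1 / 2 - y1) ^+ 2 + (t * s2 / 2 - y2) ^+ 2) ?addr_ge0 ?sqr_ge0//.
    by field.
  have MN0 : 0 <= N i j / 4 + M i j by rewrite addr_ge0 ?divr_ge0 ?cnorm2_ge0.
  move=> H; rewrite -(mulrA d); apply: le_trans (ler_wpM2l d0 H) _.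
  exact: ler_wpM2r.
(* [psA] is tr (X^2 exp A) and [psB] is tr (X^2 exp (A + X)). The inequality amounts to psB <= (5/3)
   psA. *)
have psBA : psB - psA <= (psA + psB) / 4.
  have -> : psB - psA = \sum_i \sum_j (eb j - ea i) * r i j.
    rewrite /psA /psB; under eq_bigr do rewrite rcol.
    under [X in _ - X]eq_bigr do rewrite rrow.
    rewrite (distc eb r) (dist ea r) -sumrB; apply: eq_bigr => i _.
    by rewrite -sumrB; apply: eq_bigr => j _; rewrite mulrBl.
  apply: (@le_trans _ _ (\sum_i \sum_j (ea i + eb j) / 2 * (N i j / 4 + M i j))).
    by apply: ler_sum => i _; apply: ler_sum => j _; apply: key.
  have -> : \sum_i \sum_j (ea i + eb j) / 2 * (N i j / 4 + M i j) =
     8^-1 * (psA + psB) + 2^-1 * (\sum_i ea i * \sum_j M i j + \sum_j eb j * \sum_i M i j).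
    rewrite /psA /psB (dist ea N) (distc eb N) (dist ea M) (distc eb M) -!big_split /= !mulr_sumr -big_split /=.
    apply: eq_bigr => i _; rewrite -!big_split /= !mulr_sumr -big_split /=.
    by apply: eq_bigr => j _; field.
  have HA : \sum_i ea i * \sum_j M i j <= psA / 4.
    rewrite /psA mulr_suml; apply: ler_sum => i _; rewrite -mulrA.
    exact: ler_wpM2l.
  have HB : \sum_j eb j * \sum_i M i j <= psB / 4.
    rewrite /psB mulr_suml; apply: ler_sum => i _; rewrite -mulrA.
    exact: ler_wpM2l.
  lra.
have psA0 : 0 <= psA.
  by apply: sumr_ge0 => i _; rewrite mulr_ge0// sumr_ge0// => j _; apply: cnorm2_ge0.
under [leRHS]eq_bigr do rewrite linE rowN.
(* Here 1/3 + (1/6)(5/3) = 11/18, which is below 2/3. *)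
apply: (@le_trans _ _ (\sum_i ea i + \sum_i ea i * (\sum_j (b j - a i) * W i j)
   + psA / 3 + psB / 6)); last first.
  have -> : \sum_i expR (a i) * (1 + \sum_j (b j - a i) * W i j + 2 / 3 * \sum_j N i j)
    = \sum_i ea i + \sum_i ea i * (\sum_j (b j - a i) * W i j) + 2 / 3 * psA.
    rewrite /psA mulr_sumr -!big_split /=; apply: eq_bigr => i _.
    by rewrite /ea; ring.
  lra.
(* [W] is doubly stochastic, so both traces become double sums with the same weights, and the scalar
   inequality at b_j - a_i applies pair by pair. *)
have -> : \sum_j expR (b j) = \sum_i \sum_j eb j * W i j.
  by rewrite -(distc eb W); apply: eq_bigr => j _; rewrite colW mulr1.
have -> : \sum_i ea i = \sum_i \sum_j ea i * W i j.
  by rewrite -(dist ea W); apply: eq_bigr => j _; rewrite rowW mulr1.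
rewrite /psA /psB (dist ea N) (distc eb N) (dist ea (fun i j => (b j - a i) * W i j)) !mulr_suml -!big_split /=; apply: ler_sum => i _.
rewrite !mulr_suml -!big_split /=; apply: ler_sum => j _.
rewrite !NE /ea /eb; set t := b j - a i.
have -> : expR (b j) = expR (a i) * expR t by rewrite -expRD /t addrC subrK.
have := ler_wpM2l (mulr_ge0 (expR_ge0 (a i)) (W0 i j)) (expR_le_quadratic t).
by move=> H; apply: le_trans (le_trans H _); rewrite le_eqVlt; apply/orP; left; apply/eqP; field.
Qed.

End TraceExp.

(** * Moment recursion for cosh and the Hermitian Bernstein bound *)

Section MatrixBernstein.
Context {R : realType}.
Notation C := R[i].

(** The trace of 2 cosh A - 2. *)
Definition coshtr {D} (A : 'M[C]_D) : R :=
  \sum_j (expR (eigval A j) + expR (- eigval A j) - 2).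

Lemma cosh_ge0 (x : R) : 0 <= expR x + expR (- x) - 2.
Proof. by have := expR_ge1Dx x; have := expR_ge1Dx (- x); lra. Qed.

Lemma coshtr_ge0 {D} (A : 'M[C]_D) : 0 <= coshtr A.
Proof. by apply: sumr_ge0 => j _; apply: cosh_ge0. Qed.

Lemma coshtr0 {D} : coshtr (0 : 'M[C]_D) = 0.
Proof.
have [P1 P2 E] := eigd_spectral _ (@adj0 R D D).
rewrite /coshtr big1// => j _; suff -> : eigval (0 : 'M[C]_D) j = 0.
  by rewrite oppr0 expR0; lra.
move/(congr1 (fun Z => (spectralmx 0 *m Z *m adj (spectralmx 0)) j j)): E.
rewrite mulmx0 mul0mx !mulmxA P1 mul1mx -mulmxA P1 mulmx1 !mxE eqxx mulr1n.
by case.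
Qed.

(** Apply the trace inequality to (A, X) and (-A, -X); the linear terms average to 0. With k_i the
    mean of X^2 at the i-th eigenvector of [A], the rest is (2/3) k_i (2 cosh a_i - 2) + (4/3) k_i:
    the first part uses k_i <= k0, the second only the sum of the k_i, which is where [N0] replaces
    the dimension. *)
Lemma coshtr_step {D} {J : finType} {q : J -> R} {X : J -> 'M[C]_D} {A : 'M[C]_D}
    {k0 N0 : R} :
  adj A = A -> (forall j, 0 <= q j) -> \sum_j q j = 1 ->
  (forall j, adj (X j) = X j) ->
  (forall j (y : 'rV_D), fro (y *m X j) <= fro y / 4) ->
  \sum_j (q j)%:C%C *: X j = 0 ->
  (forall y : 'rV_D, \sum_j q j * fro (y *m X j) <= k0 * fro y) ->
  \sum_j q j * fro (X j) <= N0 * k0 ->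
  \sum_j q j * coshtr (A + X j) <= (1 + 2 / 3 * k0) * coshtr A + 4 / 3 * (N0 * k0).
Proof.
move=> hA q0 q1 hX Xn Xc Xv Xt.
have EA := eigd_spectral _ hA; have [P1 P2 _] := EA.
have hAX j : adj (A + X j) = A + X j by rewrite adjD hA hX.
pose P := spectralmx A; pose a := eigval A.
pose l j i := complex.Re ((P *m X j *m adj P) i i).
pose f j i := fro (row i P *m X j).
have step j : coshtr (A + X j) <= \sum_i (expR (a i) * (1 + l j i + 2 / 3 * f j i)
    + expR (- a i) * (1 - l j i + 2 / 3 * f j i) - 2).
  have EB := eigd_spectral _ (hAX j).
  have H1 := trace_exp_perturbation EA EB (hX j) (Xn j).
  have EB' : eigd (- A + - X j) (spectralmx (A + X j)) (fun i => - eigval (A + X j) i).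
    by rewrite -opprD; apply: eigdN.
  have hN : adj (- X j) = - X j by rewrite adjN hX.
  have XnN (y : 'rV_D) : fro (y *m - X j) <= fro y / 4 by rewrite mulmxN froN.
  have H2 := trace_exp_perturbation (eigdN EA) EB' hN XnN.
  rewrite /coshtr !big_split /= lerD2r; apply: lerD; first exact: H1.
  apply: le_trans H2 _; rewrite le_eqVlt; apply/orP; left; apply/eqP.
  apply: eq_bigr => i _; rewrite mulmxN mulNmx mulmxN froN [in LHS]mxE.
  by rewrite (raddfN (@complex.Re R : Rcomplex R -> R)).
have c0 i := cosh_ge0 (a i).
have sl i : \sum_j q j * l j i = 0.
  have -> : \sum_j q j * l j i =
      complex.Re ((P *m (\sum_j (q j)%:C%C *: X j) *m adj P) i i).
    rewrite mulmx_sumr mulmx_suml summxE Re_sum; apply: eq_bigr => j _.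
    by rewrite -scalemxAr -scalemxAl mxE ReZ.
  by rewrite Xc mulmx0 mul0mx mxE.
pose k i := \sum_j q j * f j i.
have kle i : k i <= k0.
  apply: le_trans (Xv (row i P)) _; rewrite fro_rowE sum_cnorm2_row P1.
  by rewrite mxE eqxx mulr1.
have k_ge0 i : 0 <= k i by apply: sumr_ge0 => j _; rewrite mulr_ge0 ?fro_ge0.
have sk : \sum_i k i <= N0 * k0.
  apply: le_trans Xt; rewrite /k exchange_big /=; apply: ler_sum => j _.
  rewrite -mulr_sumr ler_wpM2l//.
  rewrite -(@fro_mulUl _ _ _ _ (X j) P P2) fro_row.
  by under [leRHS]eq_bigr do rewrite row_mul.
apply: (@le_trans _ _ (\sum_i ((expR (a i) + expR (- a i) - 2)
   + 2 / 3 * (k i * (expR (a i) + expR (- a i) - 2)) + 4 / 3 * k i))).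
  apply: le_trans (_ : \sum_j q j * \sum_i (expR (a i) * (1 + l j i + 2 / 3 * f j i)
    + expR (- a i) * (1 - l j i + 2 / 3 * f j i) - 2) <= _).
    by apply: ler_sum => j _; apply: ler_wpM2l.
  under eq_bigr do rewrite mulr_sumr.
  rewrite exchange_big /=; apply: ler_sum => i _.
  rewrite (_ : \sum_j _ = (expR (a i) + expR (- a i) - 2) * \sum_j q j
    + (expR (a i) - expR (- a i)) * \sum_j q j * l j i
    + 2 / 3 * (expR (a i) + expR (- a i)) * k i).
    by rewrite q1 sl; lra.
  rewrite /k !mulr_sumr -!big_split /=; apply: eq_bigr => j _; ring.
rewrite big_split big_split /= -!mulr_sumr -/(coshtr A).
have : \sum_i k i * (expR (a i) + expR (- a i) - 2) <= k0 * coshtr A.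
  by rewrite /coshtr mulr_sumr; apply: ler_sum => i _; apply: ler_wpM2r.
lra.
Qed.

Lemma big_ffunS {J : finType} (m : nat) (F : {ffun 'I_m.+1 -> J} -> R) :
  \sum_i F i = \sum_(i : {ffun 'I_m -> J}) \sum_j
     F [ffun t => if unlift ord0 t is Some t' then i t' else j].
Proof.
rewrite pair_big /=.
rewrite (reindex (fun p : {ffun 'I_m -> J} * J =>
   [ffun t : 'I_m.+1 => if unlift ord0 t is Some t' then p.1 t' else p.2])) //=.
exists (fun f => ([ffun t => f (lift ord0 t)], f ord0)) => [[i j] _|f _].
  by congr pair; [apply/ffunP => t|]; rewrite !ffunE ?liftK ?unlift_none.
apply/ffunP => t; rewrite !ffunE; case: unliftP => [t' ->|-> //].
by rewrite !ffunE.
Qed.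

Lemma sum_prod_ffun {J : finType} (q : J -> R) m :
  \sum_(i : {ffun 'I_m -> J}) \prod_t q (i t) = (\sum_j q j) ^+ m.
Proof. by rewrite -(bigA_distr_bigA (fun _ : 'I_m => q)) /= prodr_const card_ord. Qed.

(** The recursion of [coshtr_step] is affine with fixed point -2 N0; started at 0 it gives this
    closed form. *)
Lemma coshtr_iid {D} {J : finType} {q : J -> R} {X : J -> 'M[C]_D}
    {k0 N0 : R} (m : nat) :
  0 <= k0 ->
  (forall j, 0 <= q j) -> \sum_j q j = 1 ->
  (forall j, adj (X j) = X j) ->
  (forall j (y : 'rV_D), fro (y *m X j) <= fro y / 4) ->
  \sum_j (q j)%:C%C *: X j = 0 ->
  (forall y : 'rV_D, \sum_j q j * fro (y *m X j) <= k0 * fro y) ->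
  \sum_j q j * fro (X j) <= N0 * k0 ->
  \sum_(i : {ffun 'I_m -> J}) (\prod_t q (i t)) * coshtr (\sum_t X (i t))
    <= 2 * N0 * ((1 + 2 / 3 * k0) ^+ m - 1).
Proof.
move=> k00 q0 q1 hX Xn Xc Xv Xt; elim: m => [|m IH].
  rewrite expr0 subrr mulr0 big1// => i _.
  by rewrite [X in coshtr X]big_ord0 coshtr0 mulr0.
rewrite big_ffunS.
apply: (@le_trans _ _ (\sum_(i : {ffun 'I_m -> J}) (\prod_t q (i t)) *
   ((1 + 2 / 3 * k0) * coshtr (\sum_t X (i t)) + 4 / 3 * (N0 * k0)))).
  apply: ler_sum => i _.
  have hS : adj (\sum_t X (i t)) = \sum_t X (i t).
    by rewrite adj_sum; apply: eq_bigr.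
  have p0 : 0 <= \prod_t q (i t) by apply: prodr_ge0.
  have H := ler_wpM2l p0 (coshtr_step hS q0 q1 hX Xn Xc Xv Xt).
  apply: le_trans H; rewrite mulr_sumr le_eqVlt; apply/orP; left; apply/eqP.
  apply: eq_bigr => j _; rewrite !big_ord_recl !ffunE unlift_none.
  set g := finfun _; have gE t : g (lift ord0 t) = i t by rewrite ffunE liftK.
  rewrite (eq_bigr (fun t => q (i t))) => [|t _]; last by rewrite gE.
  rewrite (eq_bigr (fun t => X (i t))) => [|t _]; last by rewrite gE.
  by rewrite [X j + _]addrC mulrA [q j * _]mulrC.
under eq_bigr do rewrite mulrDr mulrCA.
rewrite big_split /= -mulr_sumr -mulr_suml sum_prod_ffun q1 expr1n mul1r.
have c0 : 0 <= 1 + 2 / 3 * k0 by lra.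
have := ler_wpM2l c0 IH; rewrite exprS.
by move: (_ ^+ m) => w; lra.
Qed.

(** A row stretched by more than s reveals an eigenvalue of modulus above s, whose term alone gives
    the bound since all terms are nonnegative. Markov's inequality for [coshtr] then controls the
    operator norm. *)
Lemma coshtr_ge {D} {A : 'M[C]_D} {y : 'rV_D} {s : R} :
  adj A = A -> 0 <= s -> s ^+ 2 * fro y < fro (y *m A) -> expR s - 2 <= coshtr A.
Proof.
move=> hA s0 H; have [P1 P2 EA] := eigd_spectral _ hA.
have [k sk] : exists k, s < `|eigval A k|.
  apply: contrapT => Hn; move: H; rewrite ltNge => /negP; apply.
  rewrite {1}EA !mulmxA fro_mulUr// -(@fro_mulUr _ _ _ _ y (adj (spectralmx A))) ?adjK//.
  rewrite /fro !big_ord1 mulr_sumr; apply: ler_sum => j _.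
  rewrite mul_mx_diag !mxE cnorm2M cnorm2_real mulrC ler_wpM2r ?cnorm2_ge0//.
  rewrite -[leLHS]real_normK ?num_real// ler_sqr ?nnegrE//.
  by rewrite leNgt; apply/negP => ?; apply: Hn; exists j.
rewrite /coshtr (bigD1 k)//= -[leLHS]addr0 lerD//; last first.
  by apply: sumr_ge0 => j _; apply: cosh_ge0.
rewrite lerD2r; have [a0|a0] := leP 0 (eigval A k).
  rewrite ger0_norm// in sk; rewrite -[leLHS]addr0 lerD ?expR_ge0// ler_expR ltW//.
rewrite ltr0_norm// in sk; rewrite -[leLHS]add0r lerD ?expR_ge0// ler_expR ltW//.
Qed.

(* [N0] plays the role of the intrinsic dimension: the bound does not depend
   on [D]. *)
Lemma matrix_bernstein {D} {J : finType} {q : J -> R} {X : J -> 'M[C]_D}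
    {k0 N0 s : R} (m : nat) :
  0 <= s -> 0 <= k0 ->
  (forall j, 0 <= q j) -> \sum_j q j = 1 ->
  (forall j, adj (X j) = X j) ->
  (forall j (y : 'rV_D), fro (y *m X j) <= fro y / 4) ->
  \sum_j (q j)%:C%C *: X j = 0 ->
  (forall y : 'rV_D, \sum_j q j * fro (y *m X j) <= k0 * fro y) ->
  \sum_j q j * fro (X j) <= N0 * k0 ->
  (\sum_(i : {ffun 'I_m -> J} |
       `[< exists y : 'rV_D, s ^+ 2 * fro y < fro (y *m \sum_t X (i t)) >])
     \prod_t q (i t)) * (expR s - 2)
    <= 2 * N0 * ((1 + 2 / 3 * k0) ^+ m - 1).
Proof.
move=> s0 k00 q0 q1 hX Xn Xc Xv Xt.
apply: le_trans (coshtr_iid m k00 q0 q1 hX Xn Xc Xv Xt).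
rewrite mulr_suml [leLHS]big_mkcond /=; apply: ler_sum => i _.
have p0 : 0 <= \prod_t q (i t) by apply: prodr_ge0.
case: asboolP => [[y Hy]|_]; last by rewrite mulr_ge0// coshtr_ge0.
rewrite ler_wpM2l//; apply: coshtr_ge Hy => //.
by rewrite adj_sum; apply: eq_bigr.
Qed.

End MatrixBernstein.

(** * Hermitian dilations and the rectangular Bernstein bound *)

Section Dilation.
Context {R : realType}.
Notation C := R[i].

Definition dil {n d} (x : 'M[C]_(n, d)) : 'M[C]_(n + d) := block_mx 0 x (adj x) 0.

Lemma dil_adj {n d} (x : 'M[C]_(n, d)) : adj (dil x) = dil x.
Proof.
by rewrite /dil {1}/adj tr_block_mx map_block_mx -/(adj _) -/(adj _) -/(adj _) -/(adj _) !adj0 adjK.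
Qed.

Lemma dilD {n d} (x y : 'M[C]_(n, d)) : dil (x + y) = dil x + dil y.
Proof. by rewrite /dil add_block_mx !addr0 adjD. Qed.

Lemma dil0 {n d} : dil (0 : 'M[C]_(n, d)) = 0.
Proof. by rewrite /dil adj0 block_mx0. Qed.

Lemma dil_sum {n d} (I : Type) (r : seq I) (P : pred I) (F : I -> 'M[C]_(n, d)) :
  dil (\sum_(i <- r | P i) F i) = \sum_(i <- r | P i) dil (F i).
Proof. by apply: (big_morph dil dilD dil0). Qed.

Lemma dilZ {n d} (t : R) (x : 'M[C]_(n, d)) : dil (t%:C%C *: x) = t%:C%C *: dil x.
Proof. by rewrite /dil scale_block_mx !scaler0 adj_rZ. Qed.

Lemma fro_row_mx {n d1 d2} (a : 'M[C]_(n, d1)) (b : 'M[C]_(n, d2)) :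
  fro (row_mx a b) = fro a + fro b.
Proof.
rewrite /fro -big_split /=; apply: eq_bigr => i _; rewrite big_split_ord /=.
by congr (_ + _); apply: eq_bigr => j _; rewrite ?row_mxEl ?row_mxEr.
Qed.

Lemma fro_col_mx {n1 n2 d} (a : 'M[C]_(n1, d)) (b : 'M[C]_(n2, d)) :
  fro (col_mx a b) = fro a + fro b.
Proof.
rewrite /fro big_split_ord /=; congr (_ + _); apply: eq_bigr => i _;
  by apply: eq_bigr => j _; rewrite ?col_mxEu ?col_mxEd.
Qed.

Lemma fro_dil {n d} (x : 'M[C]_(n, d)) : fro (dil x) = 2 * fro x.
Proof.
rewrite /dil /block_mx fro_col_mx !fro_row_mx !fro0 fro_adj add0r addr0.
by rewrite mulrDl mul1r.
Qed.

Lemma fro_mul_dil {n d} (w : 'rV[C]_(n + d)) (x : 'M[C]_(n, d)) :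
  fro (w *m dil x) = fro (rsubmx w *m adj x) + fro (lsubmx w *m x).
Proof.
by rewrite -{1}(hsubmxK w) /dil mul_row_block !mulmx0 add0r addr0 fro_row_mx.
Qed.

Lemma fro_hsub {n d} (w : 'rV[C]_(n + d)) : fro (rsubmx w) + fro (lsubmx w) = fro w.
Proof. by rewrite -{3}(hsubmxK w) fro_row_mx addrC. Qed.

Lemma froDle {n d} (a b : 'M[C]_(n, d)) : fro (a + b) <= 2 * fro a + 2 * fro b.
Proof.
rewrite /fro !mulr_sumr -big_split /=; apply: ler_sum => i _.
rewrite !mulr_sumr -big_split /=; apply: ler_sum => j _; rewrite !mxE.
case: (a i j) (b i j) => a1 a2 [b1 b2]; rewrite /cnorm2 /=.
rewrite -subr_ge0 (_ : _ - _ = (a1 - b1) ^+ 2 + (a2 - b2) ^+ 2); first by rewrite addr_ge0 ?sqr_ge0.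
by ring.
Qed.

(** For nonnegative weights this yields two facts: centring does not increase the second moment, and
    the mean inherits any uniform bound on the samples. *)
Lemma fro_variance {n d} {J : finType} (q : J -> R) (z : J -> 'M[C]_(n, d)) :
  \sum_j q j = 1 ->
  \sum_j q j * fro (z j - \sum_k (q k)%:C%C *: z k) =
    \sum_j q j * fro (z j) - fro (\sum_k (q k)%:C%C *: z k).
Proof.
move=> q1.
have var (a : J -> R) : \sum_j q j * (a j - \sum_k q k * a k) ^+ 2 =
    \sum_j q j * a j ^+ 2 - (\sum_k q k * a k) ^+ 2.
  have [M ME] : exists M, M = \sum_k q k * a k by eexists.
  rewrite -ME.
  rewrite (_ : \sum_j _ = \sum_j q j * a j ^+ 2 - 2 * M * \sum_j q j * a j + M ^+ 2 * \sum_j q j).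
    by rewrite -ME q1; ring.
  rewrite !mulr_sumr -sumrB -big_split /=; apply: eq_bigr => j _; ring.
pose m k l := \sum_j (q j)%:C%C * z j k l.
have mE k l : (\sum_j (q j)%:C%C *: z j) k l = m k l.
  by rewrite summxE; apply: eq_bigr => j _; rewrite mxE.
have cvar k l : \sum_j q j * cnorm2 (z j k l - m k l) =
    \sum_j q j * cnorm2 (z j k l) - cnorm2 (m k l).
  have mR : complex.Re (m k l) = \sum_j q j * complex.Re (z j k l).
    by rewrite Re_sum; apply: eq_bigr => j _; rewrite ReZ.
  have mI : complex.Im (m k l) = \sum_j q j * complex.Im (z j k l).
    rewrite Im_sum; apply: eq_bigr => j _; case: (z j k l) => ? ? /=.
    by rewrite mul0r addr0.
  rewrite /cnorm2 mR mI opprD.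
  under [X in _ = X + _]eq_bigr do rewrite mulrDr.
  rewrite big_split /= [RHS]addrACA -!var -big_split /=; apply: eq_bigr => j _.
  rewrite -mR -mI -mulrDr; congr (_ * _).
  by case: (z j k l) (m k l) => ? ? [? ?].
have pull (f : J -> 'M[C]_(n, d)) :
    \sum_j q j * fro (f j) = \sum_k \sum_l \sum_j q j * cnorm2 (f j k l).
  rewrite /fro; under eq_bigr do rewrite mulr_sumr.
  rewrite exchange_big; apply: eq_bigr => k _.
  by under eq_bigr do rewrite mulr_sumr; rewrite exchange_big.
rewrite !pull /fro -sumrB; apply: eq_bigr => k _; rewrite -sumrB.
apply: eq_bigr => l _; rewrite mE -cvar; apply: eq_bigr => j _.
by rewrite !mxE mE.
Qed.

(** Centred samples have squared norm at most 4 L, so 16 th^2 L <= 1 says that their scaled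
    dilations have norm at most 1/2. Dilation doubles [fro], hence the intrinsic dimension 2 n. *)
Lemma rectangular_bernstein {n d} {J : finType} {q : J -> R} {x : J -> 'M[C]_(n, d)}
    {L V th s : R} (m : nat) :
  0 <= s -> 0 <= V -> 16 * th ^+ 2 * L <= 1 ->
  (forall j, 0 <= q j) -> \sum_j q j = 1 ->
  (forall j (y : 'rV_n), fro (y *m x j) <= L * fro y) ->
  (forall j (y : 'rV_d), fro (y *m adj (x j)) <= L * fro y) ->
  (forall y : 'rV_n, \sum_j q j * fro (y *m x j) <= V * fro y) ->
  (forall y : 'rV_d, \sum_j q j * fro (y *m adj (x j)) <= V * fro y) ->
  \sum_j q j * fro (x j) <= n%:R * V ->
  (\sum_(i : {ffun 'I_m -> J} | `[< exists y : 'rV_n, s ^+ 2 * fro y <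
       th ^+ 2 * fro (y *m \sum_t (x (i t) - \sum_j (q j)%:C%C *: x j)) >])
     \prod_t q (i t)) * (expR s - 2)
    <= 4 * n%:R * ((1 + 2 / 3 * (th ^+ 2 * V)) ^+ m - 1).
Proof.
move=> s0 V0 thL q0 q1 x1 x2 v1 v2 tr1.
set G := \sum_j (q j)%:C%C *: x j.
pose X j := th%:C%C *: dil (x j - G).
have GE k (y : 'M[C]_(k, n)) : y *m G = \sum_j (q j)%:C%C *: (y *m x j).
  by rewrite mulmx_sumr; apply: eq_bigr => j _; rewrite -scalemxAr.
have GE' k (y : 'M[C]_(k, d)) : y *m adj G = \sum_j (q j)%:C%C *: (y *m adj (x j)).
  rewrite adj_sum mulmx_sumr; apply: eq_bigr => j _.
  by rewrite adj_rZ -scalemxAr.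
have var_le k l (z : J -> 'M[C]_(k, l)) :
    \sum_j q j * fro (z j - \sum_k (q k)%:C%C *: z k) <= \sum_j q j * fro (z j).
  by rewrite fro_variance// gerBl fro_ge0.
have mean_le k l (z : J -> 'M[C]_(k, l)) (M : R) :
    (forall j, fro (z j) <= M) -> fro (\sum_j (q j)%:C%C *: z j) <= M.
  move=> zM; rewrite -subr_ge0; apply: (@le_trans _ _ (\sum_j q j * fro (z j) -
      fro (\sum_k (q k)%:C%C *: z k))).
    rewrite -fro_variance//; apply: sumr_ge0 => j _.
    by rewrite mulr_ge0 ?fro_ge0.
  rewrite lerD2r -[leRHS]mul1r -q1 mulr_suml; apply: ler_sum => j _.
  by rewrite ler_wpM2l.
have G1 (y : 'rV_n) : fro (y *m G) <= L * fro y by rewrite GE; apply: mean_le.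
have G2 (y : 'rV_d) : fro (y *m adj G) <= L * fro y by rewrite GE'; apply: mean_le.
have froX (w : 'rV_(n + d)) j : fro (w *m X j) =
    th ^+ 2 * (fro (rsubmx w *m adj (x j) - rsubmx w *m adj G) +
               fro (lsubmx w *m x j - lsubmx w *m G)).
  by rewrite -scalemxAr froZ cnorm2_real fro_mul_dil adjD adjN !mulmxBr.
have Xn j (y : 'rV_(n + d)) : fro (y *m X j) <= fro y / 4.
  rewrite froX -fro_hsub.
  have h (k l : nat) (a b : 'M[C]_(k, l)) (M : R) : fro a <= M -> fro b <= M ->
      fro (a - b) <= 4 * M.
    by move=> aM bM; have := froDle a (- b); rewrite froN; lra.
  have H1 := h _ _ _ _ _ (x2 j (rsubmx y)) (G2 (rsubmx y)).
  have H2 := h _ _ _ _ _ (x1 j (lsubmx y)) (G1 (lsubmx y)).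
  apply: le_trans (ler_wpM2l (sqr_ge0 th) (lerD H1 H2)) _.
  rewrite -mulrDr -mulrDr.
  have f0 : 0 <= fro (rsubmx y) + fro (lsubmx y) by rewrite addr_ge0 ?fro_ge0.
  have := ler_wpM2r f0 thL; lra.
have Xc : \sum_j (q j)%:C%C *: X j = 0.
  under eq_bigr do rewrite /X scalerA mulrC -scalerA -dilZ.
  rewrite -scaler_sumr -dil_sum (_ : \sum_(i <- _) _ = 0) ?dil0 ?scaler0//.
  under eq_bigr do rewrite scalerBr.
  by rewrite sumrB -scaler_suml -rc_sum q1 scale1r subrr.
have Xv (y : 'rV_(n + d)) : \sum_j q j * fro (y *m X j) <= th ^+ 2 * V * fro y.
  under eq_bigr do rewrite froX mulrCA mulrDr.
  rewrite -mulr_sumr -mulrA ler_wpM2l ?sqr_ge0// big_split /= -fro_hsub mulrDr.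
  rewrite GE GE'; apply: lerD.
    by apply: le_trans (var_le _ _ _) (v2 _).
  by apply: le_trans (var_le _ _ _) (v1 _).
have Xt : \sum_j q j * fro (X j) <= 2 * n%:R * (th ^+ 2 * V).
  under eq_bigr do rewrite /X froZ cnorm2_real fro_dil mulrCA.
  under eq_bigr do rewrite (mulrCA _ 2).
  rewrite -mulr_sumr -mulr_sumr.
  have := le_trans (var_le _ _ x) tr1; rewrite -/G => H.
  have := ler_wpM2l (sqr_ge0 th) H; lra.
have hX j : adj (X j) = X j by rewrite adj_rZ dil_adj.
have k00 : 0 <= th ^+ 2 * V by rewrite mulr_ge0 ?sqr_ge0.
have := matrix_bernstein m s0 k00 q0 q1 hX Xn Xc Xv Xt.
rewrite mulrA (_ : 2 * 2 = 4 :> R); last by lra.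
(* If exp s < 2 the left side is at most 0; the enlargement of the event made afterwards needs a
   nonnegative factor. *)
have [e2|e2] := leP 0 (expR s - 2); last first.
  move=> _; apply: (@le_trans _ _ 0); last first.
    rewrite mulr_ge0 ?mulr_ge0 ?ler0n// subr_ge0; apply: exprn_ege1; lra.
  rewrite mulr_ge0_le0 ?(ltW e2)//.
  by apply: sumr_ge0 => i _; apply: prodr_ge0.
apply: le_trans; rewrite ler_wpM2r// [leLHS]big_mkcond [leRHS]big_mkcond /=.
apply: ler_sum => i _.
case: ifPn => [/asboolP[y Hy]|_]; last first.
  by case: ifP => // _; apply: prodr_ge0.
rewrite ifT //; apply/asboolP; exists (row_mx y 0).
rewrite -scaler_sumr -dil_sum -scalemxAr froZ cnorm2_real fro_mul_dil.
by rewrite row_mxKl row_mxKr mul0mx fro0 add0r fro_row_mx fro0 addr0.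
Qed.

End Dilation.

(** * Inner product spaces *)

Lemma cabs_ge0 {R : realType} (z : R[i]) : 0 <= cabs z.
Proof. exact: sqrtr_ge0. Qed.

Lemma sqr_cabs {R : realType} (z : R[i]) : cabs z ^+ 2 = cnorm2 z.
Proof. by rewrite /cabs sqr_sqrtr ?cnorm2_ge0. Qed.

Section InnerProduct.
Context {R : realType} {V : lmodType R[i]} {ip : V -> V -> R[i]}.
Context (HI : is_inner_product ip).
Implicit Types x y z : V.

Let ip_lin (a : R[i]) x y z : ip (a *: x + y) z = a * ip x z + ip y z.
Proof. by case: HI. Qed.

Lemma ipC x y : ip y x = conjc (ip x y).
Proof. by case: HI. Qed.

Lemma ip0l x : ip 0 x = 0.
Proof.
have := ip_lin 1 0 0 x; rewrite scale1r addr0 mul1r => /(congr1 (fun t : R[i] => t - ip 0 x)).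
by rewrite subrr addrK.
Qed.

Lemma ipDl x y z : ip (x + y) z = ip x z + ip y z.
Proof. by rewrite -{1}(scale1r x) ip_lin mul1r. Qed.

Lemma ipZl a x y : ip (a *: x) y = a * ip x y.
Proof. by rewrite -[a *: x]addr0 ip_lin ip0l addr0. Qed.

Lemma ip0r x : ip x 0 = 0.
Proof. by rewrite ipC ip0l conjc0. Qed.

Lemma ipDr x y z : ip x (y + z) = ip x y + ip x z.
Proof. by rewrite ipC ipDl conjcD -!ipC. Qed.

Lemma ipZr a x y : ip x (a *: y) = conjc a * ip x y.
Proof. by rewrite ipC ipZl conjcM -ipC. Qed.

Lemma ipNl x y : ip (- x) y = - ip x y.
Proof. by rewrite -scaleN1r ipZl mulN1r. Qed.

Lemma ipBl x y z : ip (x - y) z = ip x z - ip y z.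
Proof. by rewrite ipDl ipNl. Qed.

Lemma ip_suml (I : Type) (r : seq I) (P : pred I) (F : I -> V) y :
  ip (\sum_(i <- r | P i) F i) y = \sum_(i <- r | P i) ip (F i) y.
Proof. by apply: (big_morph (ip^~ y)) => [? ?|]; rewrite ?ipDl ?ip0l. Qed.

Lemma ip_sumr (I : Type) (r : seq I) (P : pred I) (F : I -> V) y :
  ip y (\sum_(i <- r | P i) F i) = \sum_(i <- r | P i) ip y (F i).
Proof. by apply: (big_morph (ip y)) => [? ?|]; rewrite ?ipDr ?ip0r. Qed.

Lemma ip_ge0 x : 0 <= complex.Re (ip x x).
Proof. by case: HI. Qed.

Lemma sqr_hnorm x : hnorm ip x ^+ 2 = complex.Re (ip x x).
Proof. by rewrite /hnorm sqr_sqrtr ?ip_ge0. Qed.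

Lemma hnorm_ge0 x : 0 <= hnorm ip x.
Proof. exact: sqrtr_ge0. Qed.

Lemma ipxx x : ip x x = (hnorm ip x ^+ 2)%:C%C.
Proof.
rewrite sqr_hnorm; have := ipC x x; case: (ip x x) => a b [/eqP].
by rewrite -addr_eq0 -mulr2n mulrn_eq0 /= => /eqP ->.
Qed.

Lemma hnorm0 : hnorm ip 0 = 0.
Proof. by rewrite /hnorm ip0l sqrtr0. Qed.

Lemma hnorm_eq0 x : hnorm ip x = 0 -> x = 0.
Proof.
move=> x0; case: HI => _ _ _; apply; rewrite ipxx x0 expr0n //.
Qed.

Lemma sqr_hnormZ a x : hnorm ip (a *: x) ^+ 2 = cnorm2 a * hnorm ip x ^+ 2.
Proof.
by apply: (@complexI R); rewrite -ipxx ipZl ipZr mulrA mul_conjc ipxx -rcM.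
Qed.

Lemma hnormZ_real (a : R) x : 0 <= a -> hnorm ip (a%:C%C *: x) = a * hnorm ip x.
Proof.
move=> a0; apply/eqP; rewrite -(@eqrXn2 _ 2) ?hnorm_ge0 ?mulr_ge0 ?hnorm_ge0//.
by rewrite sqr_hnormZ cnorm2_real exprMn.
Qed.

Lemma hnormN x : hnorm ip (- x) = hnorm ip x.
Proof.
apply/eqP; rewrite -(@eqrXn2 _ 2) ?hnorm_ge0// -scaleN1r sqr_hnormZ.
by rewrite (_ : cnorm2 _ = 1) ?mul1r// /cnorm2 /= oppr0; ring.
Qed.

Lemma cauchy_schwarz x y : cnorm2 (ip x y) <= hnorm ip x ^+ 2 * hnorm ip y ^+ 2.
Proof.
have [/hnorm_eq0 ->|y0] := eqVneq (hnorm ip y) 0.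
  by rewrite ip0r cnorm20 mulr_ge0 ?sqr_ge0.
have ny : 0 < hnorm ip y ^+ 2 by rewrite exprn_gt0// lt_def y0 hnorm_ge0.
set b := hnorm ip y ^+ 2 in ny *; set c := ip x y.
have := ip_ge0 (b%:C%C *: x - c *: y).
rewrite ipBl !ipZl -scaleNr !ipDr !ipZr (ipC x y) -/c !ipxx -/b.
rewrite conjc_real; set a := hnorm ip x ^+ 2.
have -> : complex.Re (b%:C%C * (b%:C%C * a%:C%C + conjc (- c) * c) -
   c * (b%:C%C * conjc c + conjc (- c) * b%:C%C)) = b * (b * a - cnorm2 c).
  by case: (c) => c1 c2; rewrite /cnorm2 /=; ring.
by rewrite pmulr_rge0// subr_ge0 mulrC.
Qed.

Lemma hnormD x y : hnorm ip (x + y) <= hnorm ip x + hnorm ip y.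
Proof.
rewrite -ler_sqr ?nnegrE ?hnorm_ge0 ?addr_ge0 ?hnorm_ge0//.
rewrite sqr_hnorm ipDl !ipDr !ReD -!sqr_hnorm (ipC x y).
have := cauchy_schwarz x y; case: (ip x y) => c1 c2; rewrite /cnorm2 /=.
move=> H; suff : c1 <= hnorm ip x * hnorm ip y by rewrite sqrrD; lra.
apply: le_trans (ler_norm _) _; rewrite -ler_sqr ?nnegrE ?mulr_ge0 ?hnorm_ge0//.
rewrite real_normK ?num_real// exprMn; apply: le_trans H.
by rewrite lerDl sqr_ge0.
Qed.

Lemma hnorm_sum (I : Type) (r : seq I) (P : pred I) (F : I -> V) :
  hnorm ip (\sum_(i <- r | P i) F i) <= \sum_(i <- r | P i) hnorm ip (F i).
Proof.
elim/big_rec2: _ => [|i y x _ H]; first by rewrite hnorm0.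
by apply: le_trans (hnormD _ _) _; rewrite lerD2l.
Qed.

(* The rows of [B] are coordinates of the conjugate system: they reduce finitely
   many vectors of [V] to vectors of a finite-dimensional space. *)
Lemma gram_factor {N} (u : 'I_N -> V) : exists B : 'M[R[i]]_N,
  forall c : 'rV_N, fro (c *m B) = hnorm ip (\sum_j conjc (c 0 j) *: u j) ^+ 2.
Proof.
pose G : 'M[R[i]]_N := \matrix_(j, l) ip (u l) (u j).
have hG : adj G = G by apply/matrixP => j l; rewrite !mxE -ipC.
have GE (c : 'rV_N) : (c *m G *m adj c) 0 0 =
    (hnorm ip (\sum_j conjc (c 0 j) *: u j) ^+ 2)%:C%C.
  rewrite -ipxx ip_suml !mxE; apply: eq_bigr => l _.
  rewrite ip_sumr !mxE mulr_suml; apply: eq_bigr => j _.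
  by rewrite !mxE ipZl ipZr conjcK mulrC mulrA.
have [P1 P2 E] := eigd_spectral _ hG.
set P := spectralmx G in P1 P2 E; set a := eigval G in E.
have a0 k : 0 <= a k.
  have := GE (row k P); rewrite {1}E.
  have -> : row k P *m (adj P *m diag_mx (\row_j (a j)%:C%C) *m P) *m adj (row k P)
     = row k (P *m adj P) *m diag_mx (\row_j (a j)%:C%C) *m adj (row k (P *m adj P)).
    by rewrite !row_mul !adjM adjK !mulmxA.
  rewrite P1 row1 -rowE mxE (bigD1 k)//= big1 ?addr0 => [|l lk].
    by rewrite !mxE !eqxx mulr1n conjc1 mulr1 => -[->]; apply: sqr_ge0.
  by rewrite !mxE eqxx (negbTE lk) conjc0 mulr0.
pose B := adj P *m diag_mx (\row_j (Num.sqrt (a j))%:C%C).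
have BB : B *m adj B = G.
  rewrite adjM adjK adj_map_diag mulmxA -(mulmxA (adj P)) mulmx_diag [RHS]E.
  congr (_ *m diag_mx _ *m _).
  by apply/rowP => k; rewrite !mxE -rcM -expr2 sqr_sqrtr.
exists B => c; apply: (@complexI R).
by rewrite -GE froE /mxtrace big_ord1 adjM mulmxA -(mulmxA c) BB.
Qed.

End InnerProduct.

Section StandardInnerProduct.
Context {R : realType} {n : nat}.

Definition stdip (x y : 'cV[R[i]]_n) : R[i] := \sum_k x k 0 * conjc (y k 0).

Lemma stdip_inner : is_inner_product stdip.
Proof.
split.
- move=> a x y z; rewrite /stdip mulr_sumr -big_split /=; apply: eq_bigr => k _.
  by rewrite !mxE mulrDl mulrA.
- move=> x y; rewrite /stdip conjc_sum; apply: eq_bigr => k _.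
  by rewrite conjcM conjcK mulrC.
- move=> x; rewrite /stdip Re_sum; apply: sumr_ge0 => k _.
  by rewrite mul_conjc cnorm2_ge0.
- move=> x /(congr1 (@complex.Re R)) /=; rewrite /stdip Re_sum => H.
  apply: fro_eq0; rewrite -[RHS]H /fro; apply: eq_bigr => k _.
  by rewrite big_ord1 mul_conjc.
Qed.

Lemma vnormE (x : 'cV[R[i]]_n) : vnorm x = hnorm stdip x.
Proof.
rewrite /vnorm /hnorm /stdip Re_sum; congr Num.sqrt; apply: eq_bigr => k _.
by rewrite mul_conjc.
Qed.

Lemma sqr_vnorm (x : 'cV[R[i]]_n) : vnorm x ^+ 2 = fro x.
Proof.
rewrite vnormE (sqr_hnorm stdip_inner) /stdip Re_sum; apply: eq_bigr => k _.
by rewrite big_ord1 mul_conjc.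
Qed.

Lemma stdipE (x y : 'cV[R[i]]_n) : stdip x y = (adj y *m x) 0 0.
Proof. by rewrite mxE; apply: eq_bigr => k _; rewrite adjE mulrC. Qed.

Lemma vnorm_ge0 (x : 'cV[R[i]]_n) : 0 <= vnorm x.
Proof. exact: sqrtr_ge0. Qed.

Lemma vnormD (x y : 'cV[R[i]]_n) : vnorm (x + y) <= vnorm x + vnorm y.
Proof. by rewrite !vnormE (hnormD stdip_inner). Qed.

Lemma vnormN (x : 'cV[R[i]]_n) : vnorm (- x) = vnorm x.
Proof. by rewrite !vnormE (hnormN stdip_inner). Qed.

End StandardInnerProduct.

Lemma cauchy_schwarz_mx {R : realType} {n} (y : 'rV[R[i]]_n) (x : 'cV[R[i]]_n) :
  cnorm2 ((y *m x) 0 0) <= fro y * fro x.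
Proof.
have := cauchy_schwarz stdip_inner x (adj y).
by rewrite -!vnormE !sqr_vnorm stdipE adjK fro_adj mulrC.
Qed.

(** * Concentration of averages of rank-one operators *)

Lemma big_option {R : zmodType} {J : finType} (F : option J -> R) :
  \sum_o F o = F None + \sum_j F (Some j).
Proof.
rewrite (bigD1 None)//=; congr (_ + _).
rewrite (reindex_omap (@Some J) id) => [|[]//].
by apply: eq_bigl => j; rewrite eqxx.
Qed.

Lemma sum_cauchy_schwarz {R : realType} {N} (a b : 'I_N -> R[i]) :
  cnorm2 (\sum_j a j * b j) <= (\sum_j cnorm2 (a j)) * (\sum_j cnorm2 (b j)).
Proof.
have := cauchy_schwarz_mx (\row_j a j) (\col_j b j).
rewrite mxE; under eq_bigr do rewrite !mxE.
rewrite /fro big_ord1; under [X in _ <= X * _]eq_bigr do rewrite mxE.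
by under [X in _ <= _ * X]eq_bigr do rewrite big_ord1 mxE.
Qed.

Lemma fro_mul_col_row {R : realType} {n d} (v : 'cV[R[i]]_n) (b : 'rV[R[i]]_d) :
  fro (v *m b) = fro v * fro b.
Proof.
rewrite /fro mulr_suml; apply: eq_bigr => k _; rewrite !big_ord1 mulr_sumr.
by apply: eq_bigr => l _; rewrite !mxE big_ord1 cnorm2M.
Qed.

Section Concentration.
Context {R : realType} {V : lmodType R[i]} {ip : V -> V -> R[i]}.
Context (HI : is_inner_product ip).

(** Duality between analysis and synthesis: |y|^4 is the squared modulus of the sum of c_j <u_j, y>,
    and Cauchy-Schwarz applies. The Bessel bound is asked only at the vector y itself, so that
    [frame_bessel] can use it inside the span. *)
Lemma synthesis_bound {N} {u : 'I_N -> V} {K : R} {c : 'I_N -> R[i]} : 0 <= K ->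
  (let y := \sum_j c j *: u j in
   \sum_j cnorm2 (ip y (u j)) <= K * hnorm ip y ^+ 2) ->
  hnorm ip (\sum_j c j *: u j) ^+ 2 <= K * \sum_j cnorm2 (c j).
Proof.
move=> K0; set y := \sum_j _ => /= By; set S := \sum_j cnorm2 _.
have S0 : 0 <= S by apply: sumr_ge0 => j _; apply: cnorm2_ge0.
have [->|y0] := eqVneq (hnorm ip y) 0; first by rewrite expr0n mulr_ge0.
have ny : 0 < hnorm ip y ^+ 2 by rewrite exprn_gt0// lt_def y0 hnorm_ge0.
rewrite -(ler_pM2r ny).
have -> : hnorm ip y ^+ 2 * hnorm ip y ^+ 2 = cnorm2 (\sum_j c j * ip (u j) y).
  transitivity (cnorm2 (ip y y)); first by rewrite (ipxx HI) cnorm2_real expr2.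
  rewrite {1}/y (ip_suml HI); congr cnorm2.
  by apply: eq_bigr => j _; rewrite (ipZl HI).
apply: le_trans (sum_cauchy_schwarz _ _) _; rewrite -/S [K * S]mulrC -mulrA.
apply: ler_wpM2l => //; apply: le_trans By.
by apply: ler_sum => j _; rewrite (ipC HI (u j)) cnorm2_conj.
Qed.

(** The value of [th] makes eta <= K / 2 exactly the condition 4 th Rr <= 1 of the rectangular
    bound. The deviation [eta'] is separate because truncation will consume part of [eta]. *)
Lemma finite_concentration {n N : nat} {v : 'I_N -> 'cV[R[i]]_n} {u : 'I_N -> V}
    {p : 'I_N -> R} {K Rr eta eta' th : R} (m : nat) :
  0 < K -> 0 < Rr -> (forall j, 0 <= p j) -> \sum_j p j <= 1 ->
  (forall j, fro (v j) <= Rr * p j) ->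
  (forall j, hnorm ip (u j) ^+ 2 <= Rr * p j) ->
  (forall y : 'rV_n, \sum_j cnorm2 ((y *m v j) 0 0) <= K * fro y) ->
  (forall x, \sum_j cnorm2 (ip x (u j)) <= K * hnorm ip x ^+ 2) ->
  (0 < m)%N -> 0 < eta -> eta <= K / 2 -> 0 <= eta' ->
  th = eta / (2 * Rr * K) ->
  (\sum_(i : {ffun 'I_m -> 'I_N} | `[< exists x, eta' ^+ 2 * hnorm ip x ^+ 2 <
       fro ((m%:R)^-1%:C%C *: \sum_t (((p (i t))^-1)%:C%C * ip x (u (i t))) *: v (i t)
            - \sum_j ip x (u j) *: v j) >])
     \prod_t p (i t)) * (expR (th * m%:R * eta') - 2)
    <= 4 * n%:R * ((1 + 2 / 3 * (th ^+ 2 * (Rr * K))) ^+ m - 1).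
Proof.
move=> K0 Rr0 p0 p1 Hv Hu Bv Bu m0 eta0 etaK eta'0 thE.
have th0 : 0 < th by rewrite thE divr_gt0 ?mulr_gt0.
have [B HB] := gram_factor HI u.
pose b j : 'rV_N := row j B.
have fb j : fro (b j) = hnorm ip (u j) ^+ 2.
  have := HB (delta_mx 0 j); rewrite -rowE => ->.
  rewrite (bigD1 j)//= big1 ?addr0 => [|k kj].
    by rewrite mxE !eqxx conjc1 scale1r.
  by rewrite mxE (negbTE kj) andbF conjc0 scale0r.
(* When p_j = 0 the inverse is 0 by convention, and [Hv], [Hu] force v_j = u_j = 0. *)
have invp j : (p j)^-1 * (Rr * p j) <= Rr.
  have [->|pj] := eqVneq (p j) 0; first by rewrite !mulr0 ltW.
  by rewrite mulrCA mulVf// mulr1.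
have invp0 j : 0 <= (p j)^-1 by rewrite invr_ge0.
have nv j : (p j)^-1 * fro (v j) <= Rr.
  by apply: le_trans (invp j); apply: ler_wpM2l.
have nb j : (p j)^-1 * fro (b j) <= Rr.
  by rewrite fb; apply: le_trans (invp j); apply: ler_wpM2l.
(* [None] carries the mass of [p] outside the first [N] indices. *)
pose q (o : option 'I_N) : R := if o is Some j then p j else 1 - \sum_j p j.
pose xx (o : option 'I_N) : 'M[R[i]]_(n, N) :=
  if o is Some j then ((p j)^-1)%:C%C *: (v j *m b j) else 0.
have q0 o : 0 <= q o by case: o => [j|] /=; rewrite ?subr_ge0.
have q1 : \sum_o q o = 1 by rewrite big_option /= subrK.
have Rr2 : 0 <= Rr ^+ 2 by rewrite sqr_ge0.
have froy j (y : 'rV_n) : fro (y *m xx (Some j)) =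
    cnorm2 ((y *m v j) 0 0) * ((p j)^-1 ^+ 2 * fro (b j)).
  rewrite /= -scalemxAr froZ cnorm2_real mulmxA.
  by rewrite [in LHS](mx11_scalar (y *m v j)) mul_scalar_mx froZ mulrCA.
have froz j (z : 'rV_N) : fro (z *m adj (xx (Some j))) =
    cnorm2 ((z *m adj (b j)) 0 0) * ((p j)^-1 ^+ 2 * fro (v j)).
  rewrite /= adj_rZ adjM -scalemxAr froZ cnorm2_real mulmxA.
  by rewrite [in LHS](mx11_scalar (z *m adj (b j))) mul_scalar_mx froZ fro_adj mulrCA.
have x1 o (y : 'rV_n) : fro (y *m xx o) <= Rr ^+ 2 * fro y.
  case: o => [j|]; last by rewrite mulmx0 fro0 mulr_ge0 ?fro_ge0.
  rewrite froy; have H := cauchy_schwarz_mx y (v j).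
  apply: le_trans (ler_wpM2r _ H) _; first by rewrite mulr_ge0 ?sqr_ge0 ?fro_ge0.
  rewrite (_ : fro y * fro (v j) * ((p j)^-1 ^+ 2 * fro (b j)) =
    ((p j)^-1 * fro (v j)) * ((p j)^-1 * fro (b j)) * fro y); last by ring.
  by rewrite ler_wpM2r ?fro_ge0// expr2 ler_pM ?mulr_ge0 ?fro_ge0.
have x2 o (y : 'rV_N) : fro (y *m adj (xx o)) <= Rr ^+ 2 * fro y.
  case: o => [j|]; last by rewrite /= adj0 mulmx0 fro0 mulr_ge0 ?fro_ge0.
  rewrite froz; have H := cauchy_schwarz_mx y (adj (b j)); rewrite fro_adj in H.
  apply: le_trans (ler_wpM2r _ H) _; first by rewrite mulr_ge0 ?sqr_ge0 ?fro_ge0.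
  rewrite (_ : fro y * fro (b j) * ((p j)^-1 ^+ 2 * fro (v j)) =
    ((p j)^-1 * fro (v j)) * ((p j)^-1 * fro (b j)) * fro y); last by ring.
  by rewrite ler_wpM2r ?fro_ge0// expr2 ler_pM ?mulr_ge0 ?fro_ge0.
have scal j (a f : R) : 0 <= a -> 0 <= f -> (p j)^-1 * f <= Rr ->
    p j * (a * ((p j)^-1 ^+ 2 * f)) <= Rr * a.
  move=> a0 f0 H; have [->|pj] := eqVneq (p j) 0.
    by rewrite mul0r mulr_ge0// ltW.
  rewrite (_ : p j * _ = ((p j)^-1 * f) * a * (p j * (p j)^-1)); last by ring.
  by rewrite mulfV// mulr1 ler_wpM2r.
have v1 (y : 'rV_n) : \sum_o q o * fro (y *m xx o) <= Rr * K * fro y.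
  rewrite big_option [xx None]/= mulmx0 fro0 mulr0 add0r -mulrA.
  apply: le_trans (ler_wpM2l (ltW Rr0) (Bv y)); rewrite mulr_sumr.
  apply: ler_sum => j _; rewrite froy; apply: scal => //; first exact: cnorm2_ge0.
  exact: fro_ge0.
have v2 (z : 'rV_N) : \sum_o q o * fro (z *m adj (xx o)) <= Rr * K * fro z.
  rewrite big_option [xx None]/= adj0 mulmx0 fro0 mulr0 add0r -mulrA.
  apply: (@le_trans _ _ (Rr * \sum_j cnorm2 ((z *m adj (b j)) 0 0))).
    rewrite mulr_sumr; apply: ler_sum => j _; rewrite froz; apply: scal => //.
      exact: cnorm2_ge0.
    exact: fro_ge0.
  apply: ler_wpM2l; first exact: ltW.
  (* The bound K for w -> w B, known from [synthesis_bound], is transferred to the adjoint: |w|^4 =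
     |<w B, z>|^2 <= K |w|^2 |z|^2. *)
  pose w := z *m adj B.
  have wE : \sum_j cnorm2 ((z *m adj (b j)) 0 0) = fro w.
    rewrite /fro big_ord1; apply: eq_bigr => j _; congr cnorm2.
    by rewrite !mxE; apply: eq_bigr => k _; rewrite !mxE.
  rewrite wE; have [->|w0] := eqVneq (fro w) 0.
    by rewrite mulr_ge0 ?fro_ge0// ltW.
  have wp : 0 < fro w by rewrite lt_def w0 fro_ge0.
  have := cauchy_schwarz_mx (w *m B) (adj z).
  have -> : (w *m B *m adj z) 0 0 = (fro w)%:C%C.
    rewrite froE /mxtrace big_ord1 /w adjM adjK !mulmxA.
    by [].
  rewrite cnorm2_real fro_adj HB => H.
  have := @synthesis_bound _ u K (fun j => conjc (w 0 j)) (ltW K0) (Bu _).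
  under [X in K * X]eq_bigr do rewrite cnorm2_conj.
  rewrite (_ : \sum_j cnorm2 (w 0 j) = fro w); last by rewrite /fro big_ord1.
  move=> /(ler_wpM2r (fro_ge0 z)) /(le_trans H).
  by rewrite expr2 mulrAC ler_pM2r.
(* The bound [Bv], tested on the n coordinate rows, sums the |v_j|^2; this yields the factor n,
   independent of [N]. *)
have tr1 : \sum_o q o * fro (xx o) <= n%:R * (Rr * K).
  rewrite big_option [xx None]/= fro0 mulr0 add0r.
  apply: (@le_trans _ _ (Rr * \sum_j fro (v j))).
    rewrite mulr_sumr; apply: ler_sum => j _.
    rewrite froZ cnorm2_real fro_mul_col_row [X in _ * X]mulrCA.
    by apply: scal; rewrite ?fro_ge0.
  rewrite mulrCA; apply: ler_wpM2l; first exact: ltW.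
  rewrite /fro exchange_big /=.
  apply: (@le_trans _ _ (\sum_(k < n) K)); last by rewrite sumr_const card_ord mulr_natl.
  apply: ler_sum => k _; have := Bv (delta_mx 0 k).
  rewrite (_ : fro (delta_mx 0 k) = 1) ?mulr1.
    apply: le_trans; apply: ler_sum => j _; rewrite big_ord1 -rowE.
    by rewrite mxE.
  rewrite /fro big_ord1 (bigD1 k)//= big1 ?addr0 => [|l lk].
    by rewrite mxE !eqxx /cnorm2 /= expr1n expr0n addr0.
  by rewrite mxE (negbTE lk) andbF cnorm20.
have thL : 16 * th ^+ 2 * Rr ^+ 2 <= 1.
  rewrite (_ : 16 * th ^+ 2 * Rr ^+ 2 = (2 * eta / K) ^+ 2); last first.
    by rewrite thE; field; rewrite !gt_eqF.
  rewrite expr_le1// ?divr_ge0 ?mulr_ge0 ?(ltW eta0) ?(ltW K0)//.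
  by rewrite ler_pdivrMr//; lra.
have s0 : 0 <= th * m%:R * eta' by rewrite !mulr_ge0// ltW.
have RK0 : 0 <= Rr * K by rewrite mulr_ge0 ?ltW.
have := rectangular_bernstein m s0 RK0 thL q0 q1 x1 x2 v1 v2 tr1.
have [e2|e2] := leP 0 (expR (th * m%:R * eta') - 2); last first.
  move=> _; apply: (@le_trans _ _ 0); last first.
    rewrite mulr_ge0 ?mulr_ge0 ?ler0n// subr_ge0; apply: exprn_ege1.
    by rewrite lerDl !mulr_ge0 ?invr_ge0// ?ltW.
  rewrite mulr_ge0_le0 ?(ltW e2)//.
  by apply: sumr_ge0 => i _; apply: prodr_ge0.
apply: le_trans; apply: ler_wpM2r => //.
pose h (i : {ffun 'I_m -> 'I_N}) : {ffun 'I_m -> option 'I_N} := [ffun t => Some (i t)].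
have h_inj : injective h.
  by move=> i i' /ffunP H; apply/ffunP => t; have := H t; rewrite !ffunE => -[].
set G := \sum_j (q j)%:C%C *: xx j.
pose hat (i : {ffun 'I_m -> 'I_N}) x :=
  (m%:R^-1)%:C%C *: \sum_t (((p (i t))^-1)%:C%C * ip x (u (i t))) *: v (i t)
            - \sum_j ip x (u j) *: v j.
pose Pbad i := `[< exists x, eta' ^+ 2 * hnorm ip x ^+ 2 < fro (hat i x) >].
pose Pbad' (i' : {ffun 'I_m -> option 'I_N}) := `[< exists y : 'rV_n,
  (th * m%:R * eta') ^+ 2 * fro y < th ^+ 2 * fro (y *m \sum_t (xx (i' t) - G)) >].
suff Hbad i : Pbad i -> Pbad' (h i).
  apply: (@le_trans _ _ (\sum_(i' in h @: [set i | Pbad i]%SET) \prod_t q (i' t))).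
    rewrite big_imset /=; last by move=> ? ? _ _; apply: h_inj.
    rewrite le_eqVlt; apply/orP; left; apply/eqP.
    apply: eq_big => [i|i _]; first by rewrite finset.in_set.
    by apply: eq_bigr => t _; rewrite ffunE.
  rewrite [leLHS]big_mkcond [leRHS]big_mkcond /=; apply: ler_sum => i' _.
  case: ifPn => [/imsetP[i iP ->]|_].
    by rewrite finset.in_set in iP; have := Hbad _ iP; rewrite /Pbad' => ->.
  by case: ifP => // _; apply: prodr_ge0.
rewrite /Pbad /Pbad' => /asboolP[x]; set H := hat i x => Hx.
(* An x with large image error H gives a row with large image under the adjoint error, namely adj H.
   Pairing that image with x gives m |H|^2, and Cauchy-Schwarz concludes. *)
apply/asboolP; exists (adj H); rewrite fro_adj.
pose y := adj H.
have H0 : 0 < fro H by apply: le_lt_trans Hx; rewrite mulr_ge0 ?sqr_ge0.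
have GE : G = \sum_j v j *m b j.
  rewrite /G big_option [xx None]/= scaler0 add0r; apply: eq_bigr => j _ /=.
  rewrite scalerA -rcM; have [pj|pj] := eqVneq (p j) 0; last by rewrite mulfV// scale1r.
  have := Hv j; rewrite pj mulr0 => vj.
  have -> : v j = 0 by apply: fro_eq0; apply/eqP; rewrite eq_le vj fro_ge0.
  by rewrite mul0mx scaler0.
pose L (c : 'rV[R[i]]_N) := \sum_j conjc (c 0 j) *: u j.
have LD c d : L (c + d) = L c + L d.
  by rewrite /L -big_split; apply: eq_bigr => j _; rewrite mxE conjcD scalerDl.
have L0 : L 0 = 0 by rewrite /L big1// => j _; rewrite mxE conjc0 scale0r.
have Ld a j : L (a *: delta_mx 0 j) = conjc a *: u j.
  rewrite /L (bigD1 j)//= big1 ?addr0 => [|k kj].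
    by rewrite !mxE !eqxx mulr1.
  by rewrite !mxE (negbTE kj) andbF mulr0 conjc0 scale0r.
have Lsum (I : finType) (F : I -> 'rV[R[i]]_N) : L (\sum_t F t) = \sum_t L (F t).
  exact: (big_morph L LD L0).
pose g j := (y *m v j) 0 0.
have yvb j : y *m (v j *m b j) = g j *: delta_mx 0 j *m B.
  by rewrite mulmxA (mx11_scalar (y *m v j)) mul_scalar_mx -scalemxAl -rowE.
(* Coordinates of the image before multiplication by [B]: [HB] then identifies the norm of c B with
   that of the vector L c of [V], which can be paired with x. *)
pose c := \sum_t (((p (i t))^-1)%:C%C * g (i t)) *: delta_mx 0 (i t)
  + \sum_j (- m%:R * g j) *: delta_mx 0 j : 'rV[R[i]]_N.
have yM : y *m \sum_t (xx (h i t) - G) = c *m B.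
  rewrite sumrB mulmxBr sumr_const card_ord GE /c mulmxDl; congr (_ + _).
    rewrite mulmx_sumr mulmx_suml; apply: eq_bigr => t _; rewrite ffunE /=.
    by rewrite -scalemxAr yvb -!scalemxAl scalerA.
  rewrite -scaler_nat -scalemxAr mulmx_sumr mulmx_suml scaler_sumr -sumrN.
  apply: eq_bigr => j _.
  by rewrite yvb -!scalemxAl mulNr scaleNr scalerA.
have ipL : ip x (L c) = (m%:R * fro H)%:C%C.
  rewrite /c LD !Lsum (ipDr HI) !(ip_sumr HI).
  under eq_bigr do rewrite Ld (ipZr HI) conjcK.
  under [X in _ + X]eq_bigr do rewrite Ld (ipZr HI) conjcK.
  have yH : (y *m H) 0 0 = (fro H)%:C%C.
    by rewrite -fro_adj froE /mxtrace big_ord1 adjK.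
  have mC : (m%:R : R)%:C%C = m%:R by rewrite rmorph_nat.
  rewrite rcM -yH /H /hat mulmxBr -scalemxAr !mulmx_sumr !mxE !summxE mulrBr mulrA -rcM.
  rewrite mulfV ?pnatr_eq0 -?lt0n// mul1r; congr (_ + _).
    by apply: eq_bigr => t _; rewrite -scalemxAr [in RHS]mxE -/(g _) mulrAC.
  rewrite mulr_sumr -sumrN; apply: eq_bigr => j _.
  by rewrite -scalemxAr [in RHS]mxE -/(g _) mC; ring.
rewrite yM HB -/(L c).
have := cauchy_schwarz HI x (L c); rewrite ipL cnorm2_real => CS.
rewrite ltNge; apply/negP => Hle.
have thn : th ^+ 2 * hnorm ip (L c) ^+ 2 <= th ^+ 2 * (m%:R ^+ 2 * eta' ^+ 2 * fro H).
  by apply: le_trans Hle _; rewrite le_eqVlt; apply/orP; left; apply/eqP; ring.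
rewrite ler_pM2l ?exprn_gt0// in thn.
have := le_trans CS (ler_wpM2l (sqr_ge0 (hnorm ip x)) thn).
have m2 : 0 < (m%:R : R) ^+ 2 * fro H by rewrite mulr_gt0// exprn_gt0// ltr0n.
rewrite (_ : (m%:R * fro H) ^+ 2 = (m%:R ^+ 2 * fro H) * fro H); last by ring.
rewrite (_ : hnorm ip x ^+ 2 * (m%:R ^+ 2 * eta' ^+ 2 * fro H) =
  (m%:R ^+ 2 * fro H) * (eta' ^+ 2 * hnorm ip x ^+ 2)); last by ring.
by rewrite ler_pM2l// leNgt Hx.
Qed.

Definition sample_mean {n m : nat} (v : nat -> 'cV[R[i]]_n) (u : nat -> V) (p : nat -> R)
    (i : 'I_m -> nat) (x : V) : 'cV[R[i]]_n :=
  (m%:R^-1)%:C%C *: \sum_t (((p (i t))^-1)%:C%C * ip x (u (i t))) *: v (i t).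

(** Here y0 is th m eta, and 1/3 is the loss allowed in the exponent. If bad exceeded dl / 2,
    multiplying by F = 28 n / dl would give 14 n (2/3 E - 2) <= 4 n E with E = exp y0, so E <= 21/4,
    against E >= F >= 28. *)
Lemma concentration_numerics (n dl y0 s bad : R) :
  1 <= n -> 0 < dl -> dl < 1 -> 0 <= bad ->
  5 / 3 * ln (28 * n / dl) <= y0 -> y0 - 1 / 3 <= s ->
  bad * (expR s - 2) <= 4 * n * expR (y0 / 3) -> bad <= dl / 2.
Proof.
move=> n1 dl0 dl1 bad0 Hy Hs Hb.
set F := 28 * n / dl in Hy.
have F28 : 28 <= F by rewrite /F ler_pdivlMr//; nra.
have F0 : 0 < F by lra.
have L0 : 0 <= ln F by rewrite ln_ge0//; lra.
pose E := expR y0; pose a := expR (y0 / 3).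
have EF : F <= E by rewrite -[F]lnK ?posrE// ler_expR; lra.
have aF : a * F <= E by rewrite -[F]lnK ?posrE// -expRD ler_expR; lra.
have e13 : 2 / 3 <= expR (- (1 / 3)) :> R by have := expR_ge1Dx (- (1 / 3) : R); lra.
have Es : 2 / 3 * E <= expR s.
  apply: (@le_trans _ _ (expR (- (1 / 3)) * E)); first by rewrite ler_wpM2r ?expR_ge0.
  by rewrite -expRD ler_expR; lra.
have a0 : 0 < a by exact: expR_gt0.
rewrite leNgt; apply/negP => Hbad.
have H1 : dl / 2 * (2 / 3 * E - 2) <= 4 * n * a.
  apply: le_trans Hb; apply: ler_pM; try lra.
have := ler_wpM2r (ltW F0) H1.
have -> : dl / 2 * (2 / 3 * E - 2) * F = 14 * n * (2 / 3 * E - 2).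
  by rewrite /F; field; rewrite gt_eqF.
have : 4 * n * a * F <= 4 * n * E by rewrite -mulrA ler_wpM2l//; lra.
nra.
Qed.

Lemma partial_sums_cvg (p : nat -> R) :
  (forall j, 0 <= p j) -> (\sum_(j <oo) (p j)%:E = 1)%E ->
  (forall N, \sum_(j < N) p j <= 1) /\
  (forall e, 0 < e -> exists N0, forall N, (N0 <= N)%N -> 1 - e <= \sum_(j < N) p j).
Proof.
move=> p0 p1.
have pE0 k : (0%N <= k)%N -> true -> (0%E <= (p k)%:E)%E by rewrite lee_fin.
split=> [N|e e0].
  by have := nneseries_lim_ge N pE0; rewrite p1 big_mkord sumEFin lee_fin.
have [N0 HN0] : exists N0, 1 - e <= \sum_(j < N0) p j.
  apply: contrapT => H.
  suff : (\sum_(j <oo) (p j)%:E <= (1 - e)%:E)%E by rewrite p1 lee_fin; lra.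
  apply: lime_le; first exact: is_cvg_nneseries.
  apply: nearW => N; rewrite big_mkord sumEFin lee_fin leNgt.
  by apply/negP => HN; apply: H; exists N; apply: ltW.
exists N0 => N NN; apply: le_trans HN0 _.
rewrite -(big_mkord xpredT p) -(big_mkord xpredT p) (big_cat_nat (leq0n _) NN) /=.
by rewrite lerDl; apply: sumr_ge0.
Qed.

Lemma hnormZ a x : hnorm ip (a *: x) = cabs a * hnorm ip x.
Proof.
apply/eqP; rewrite -(@eqrXn2 _ 2) ?mulr_ge0 ?hnorm_ge0 ?cabs_ge0//.
by rewrite (sqr_hnormZ HI) exprMn sqr_cabs.
Qed.

Lemma cabs_ip x y : cabs (ip x y) <= hnorm ip x * hnorm ip y.
Proof.
rewrite -ler_sqr ?nnegrE ?mulr_ge0 ?hnorm_ge0 ?cabs_ge0//.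
by rewrite sqr_cabs exprMn (cauchy_schwarz HI).
Qed.

End Concentration.

Lemma vnormZ {R : realType} {n} (a : R[i]) (x : 'cV[R[i]]_n) :
  vnorm (a *: x) = cabs a * vnorm x.
Proof. by rewrite !vnormE (hnormZ stdip_inner). Qed.

Lemma vnorm_sum {R : realType} {n} (I : Type) (r : seq I) (P : pred I) (F : I -> 'cV[R[i]]_n) :
  vnorm (\sum_(i <- r | P i) F i) <= \sum_(i <- r | P i) vnorm (F i).
Proof.
rewrite vnormE; under [leRHS]eq_bigr do rewrite vnormE.
exact: (hnorm_sum stdip_inner).
Qed.

(** The bound holds for all large N, so that several applications can share one truncation. *)
Lemma concentration {R : realType} {V : lmodType R[i]} {ip : V -> V -> R[i]} {n : nat}
    {v : nat -> 'cV[R[i]]_n} {u : nat -> V} {p : nat -> R} {K Rr eta dl : R}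
    {G : V -> 'cV[R[i]]_n} {m : nat} :
  is_inner_product ip -> 0 < K -> 0 < Rr -> (forall j, 0 <= p j) ->
  (\sum_(j <oo) (p j)%:E = 1)%E ->
  (forall j, vnorm (v j) ^+ 2 <= Rr * p j) ->
  (forall j, hnorm ip (u j) ^+ 2 <= Rr * p j) ->
  (forall N (y : 'rV_n), \sum_(j < N) cnorm2 ((y *m v j) 0 0) <= K * fro y) ->
  (forall N x, \sum_(j < N) cnorm2 (ip x (u j)) <= K * hnorm ip x ^+ 2) ->
  (forall x e, 0 < e -> exists M0, forall M, (M0 <= M)%N ->
     vnorm (\sum_(j < M) ip x (u j) *: v j - G x) < e) ->
  0 < dl -> dl < 1 -> (0 < n)%N -> 0 < eta -> eta <= K / 2 ->
  Mtilde K Rr n eta dl <= m%:R ->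
  exists N0, forall N, (N0 <= N)%N ->
    \sum_(i : {ffun 'I_m -> 'I_N} | `[< exists x,
        eta * hnorm ip x < vnorm (@sample_mean _ _ ip n m v u p (fun t => i t) x - G x) >])
      \prod_t p (i t) <= dl / 2.
Proof.
move=> HI K0 Rr0 p0 p1 Hv Hu Bv Bu GL dl0 dl1 n0 eta0 etaK Hm.
have [P1 PL] := partial_sums_cvg _ p0 p1.
have uv j : hnorm ip (u j) * vnorm (v j) <= Rr * p j.
  rewrite -ler_sqr ?nnegrE ?mulr_ge0 ?hnorm_ge0 ?vnorm_ge0 ?(ltW Rr0)//.
  by rewrite exprMn expr2 ler_pM ?sqr_ge0// -expr2.
have [th thE] : exists th, th = eta / (2 * Rr * K) by eexists.
have n1 : 1 <= n%:R :> R by rewrite ler1n.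
have L0 : 0 < ln (28 * n%:R / dl).
  by rewrite ln_gt0// ltr_pdivlMr//; lra.
have m0 : (0 < m)%N.
  rewrite -(ltr_nat R); apply: lt_le_trans Hm.
  by rewrite divr_gt0 ?exprn_gt0// !mulr_gt0//; lra.
have m0R : 0 < m%:R :> R by rewrite ltr0n.
have th0 : 0 < th by rewrite thE divr_gt0 ?mulr_gt0.
(* The first entry keeps the truncation error [ep] below [eta]; the second keeps the loss th m ep in
   the exponent below 1/3. *)
pose e0 := Num.min (eta / Rr) (1 / (3 * th * m%:R * Rr)).
have e00 : 0 < e0.
  rewrite lt_min; apply/andP; split; first exact: divr_gt0.
  by rewrite div1r invr_gt0 !mulr_gt0.
have [N0 HN0] := PL _ e00.
exists N0 => N NN; have {HN0} HN := HN0 _ NN.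
pose ep := Rr * (1 - \sum_(j < N) p j).
have ep0 : 0 <= ep by rewrite mulr_ge0 ?subr_ge0 ?P1// ltW.
have epR : ep <= Rr * e0 by rewrite ler_wpM2l ?(ltW Rr0)//; lra.
have ep1 : ep <= eta.
  apply: le_trans epR _; rewrite mulrC -ler_pdivlMr// /e0.
  by rewrite ge_min lexx.
have ep2 : th * m%:R * ep <= 1 / 3.
  have : ep <= Rr * (1 / (3 * th * m%:R * Rr)).
    by apply: le_trans epR _; rewrite ler_wpM2l ?(ltW Rr0)// ge_min lexx orbT.
  move=> /(ler_wpM2l (mulr_ge0 (ltW th0) (ltW m0R))) /le_trans; apply.
  by rewrite le_eqVlt; apply/orP; left; apply/eqP; field; rewrite !gt_eqF.
(* The tail of the series is dominated by Rr p_j |x|, because |u_j| |v_j| <= Rr p_j. *)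
have GN x : vnorm (\sum_(j < N) ip x (u j) *: v j - G x) <= ep * hnorm ip x.
  apply/ler_addgt0Pr => e e_gt0; have [M0 HM0] := GL x e e_gt0.
  pose M := maxn N M0; have NM : (N <= M)%N by rewrite leq_maxl.
  have {}HM0 := HM0 M (leq_maxr _ _).
  have -> : \sum_(j < N) ip x (u j) *: v j - G x =
     - (\sum_(N <= j < M) ip x (u j) *: v j) + (\sum_(j < M) ip x (u j) *: v j - G x).
    rewrite addrA; congr (_ - _).
    rewrite -(big_mkord xpredT (fun j => ip x (u j) *: v j)).
    rewrite -(big_mkord xpredT (fun j => ip x (u j) *: v j)) (big_cat_nat (leq0n _) NM) /=.
    by rewrite addrCA addNr addr0.
  apply: le_trans (vnormD _ _) _; rewrite vnormN; apply: lerD; last exact: ltW.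
  apply: le_trans (vnorm_sum _ _ _ _) _.
  apply: (@le_trans _ _ (\sum_(N <= j < M) Rr * p j * hnorm ip x)).
    apply: ler_sum => j _; rewrite vnormZ.
    apply: le_trans (ler_wpM2r (vnorm_ge0 _) (cabs_ip HI _ _)) _.
    by rewrite -(mulrA (hnorm ip x)) [leLHS]mulrC ler_wpM2r ?hnorm_ge0.
  rewrite -mulr_suml ler_wpM2r ?hnorm_ge0// -mulr_sumr ler_wpM2l ?(ltW Rr0)//.
  have := P1 M; rewrite -(big_mkord xpredT p) (big_cat_nat (leq0n _) NM) /= big_mkord.
  lra.
have Hv' (j : 'I_N) : fro (v j) <= Rr * p j by rewrite -sqr_vnorm.
have key := fun h => finite_concentration HI m K0 Rr0 (fun j : 'I_N => p0 j) (P1 N)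
  Hv' (fun j : 'I_N => Hu j) (Bv N) (Bu N) m0 eta0 etaK h thE.
have ee : 0 <= eta - ep by rewrite subr_ge0.
have {}key := key _ ee.
set bad := (X in X <= _).
pose y0 := th * m%:R * eta.
apply: (@concentration_numerics _ n%:R dl y0 (th * m%:R * (eta - ep)) bad) => //.
- by apply: sumr_ge0 => i _; apply: prodr_ge0.
- move: Hm; rewrite /Mtilde ler_pdivrMr ?exprn_gt0// => Hm.
  have -> : y0 = m%:R * eta ^+ 2 / (2 * Rr * K) by rewrite /y0 thE; field; rewrite !gt_eqF.
  rewrite ler_pdivlMr ?mulr_gt0//; apply: le_trans Hm.
  by rewrite le_eqVlt; apply/orP; left; apply/eqP; field.
- by rewrite mulrBr -/y0; lra.
have E0 : (1 + 2 / 3 * (th ^+ 2 * (Rr * K))) ^+ m - 1 <= expR (y0 / 3).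
  have -> : y0 / 3 = m%:R * (2 / 3 * (th ^+ 2 * (Rr * K))).
    by rewrite /y0 thE; field; rewrite !gt_eqF.
  rewrite expRM_natl; set z := 2 / 3 * _.
  have z0 : 0 <= z by rewrite !mulr_ge0 ?sqr_ge0// ltW.
  have : (1 + z) ^+ m <= expR z ^+ m.
    by rewrite lerXn2r ?nnegrE ?expR_ge0 ?expR_ge1Dx// addr_ge0.
  lra.
have [e2|e2] := leP 0 (expR (th * m%:R * (eta - ep)) - 2); last first.
  apply: (@le_trans _ _ 0); last by rewrite !mulr_ge0 ?expR_ge0.
  rewrite mulr_ge0_le0 ?(ltW e2)//.
  by apply: sumr_ge0 => i _; apply: prodr_ge0.
apply: le_trans (le_trans _ key) _; last by rewrite ler_wpM2l// mulr_ge0.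
apply: ler_wpM2r => //; rewrite /bad [leLHS]big_mkcond [leRHS]big_mkcond /=.
apply: ler_sum => i _; case: ifPn => [/asboolP[x Hx]|_]; last first.
  by case: ifP => // _; apply: prodr_ge0.
rewrite ifT//; apply/asboolP; exists x.
rewrite -exprMn -sqr_vnorm ltrXn2r ?nnegrE ?mulr_ge0 ?hnorm_ge0 ?vnorm_ge0//=.
set S := \sum_(j < N) _.
have := vnormD (@sample_mean _ _ ip n m v u p (fun t => i t) x - S) (S - G x).
rewrite addrA subrK => /(lt_le_trans Hx) H.
by have := GN x; rewrite mulrBl; rewrite -/S; move: H; rewrite /sample_mean; lra.
Qed.

(** The infinite sum is bounded below by its restriction to samples with all indices below N. These
    have total mass (p_0 + ... + p_(N-1))^m, from which a union bound removes the two bad events. *)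
Lemma iid_prob_ge {R : realType} {p : nat -> R} {m N : nat} {E : set {ffun 'I_m -> nat}}
    (B1 B2 : pred {ffun 'I_m -> 'I_N}) :
  (forall j, 0 <= p j) ->
  (forall i, ~~ B1 i -> ~~ B2 i -> E [ffun t => i t : nat]) ->
  (((\sum_(j < N) p j) ^+ m - \sum_(i | B1 i) \prod_t p (i t)
      - \sum_(i | B2 i) \prod_t p (i t))%:E <= iid_prob p E)%E.
Proof.
move=> p0 HE; pose B i := ~~ B1 i && ~~ B2 i.
pose h (i : {ffun 'I_m -> 'I_N}) : {ffun 'I_m -> nat} := [ffun t => i t : nat].
have h_inj : injective h.
  move=> i i' /ffunP H; apply/ffunP => t; apply: val_inj.
  by have := H t; rewrite !ffunE.
have w0 (i : {ffun 'I_m -> 'I_N}) : 0 <= \prod_t p (i t) by apply: prodr_ge0.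
apply: (@le_trans _ _ (\sum_(i | B i) \prod_t p (i t))%:E).
  rewrite lee_fin -(sum_prod_ffun (fun j : 'I_N => p j)).
  rewrite -!addrA -opprD lerBlDr.
  rewrite [X in _ <= X + _]big_mkcond [X in _ <= _ + (X + _)]big_mkcond.
  rewrite [X in _ <= _ + (_ + X)]big_mkcond /= -!big_split /=.
  apply: ler_sum => i _; have := w0 i; rewrite /B.
  by case: (B1 i); case: (B2 i) => /=; lra.
pose r := [seq h i | i <- enum B].
have ur : uniq r by rewrite map_inj_uniq ?enum_uniq.
apply: esum_ge; exists [set` r].
  split; first exact: finite_seq.
  move=> i' /= i'r.
  have [i iB ->] : exists2 i, i \in enum B & i' = h i by apply/mapP.
  by move: iB; rewrite mem_enum => /andP[b1 b2]; apply: HE.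
rewrite (@fsbigE _ _ _ _ _ r)//; last by move=> i /= ->.
rewrite big_map -sumEFin le_eqVlt; apply/orP; left; apply/eqP; symmetry.
rewrite big_enum_cond; apply: eq_big => [i|i _]; last by congr EFin; apply: eq_bigr => t _; rewrite ffunE.
apply/andP/idP => [[]//|iB]; split => //.
apply: mem_set => /=; apply/mapP; exists i => //.
by rewrite mem_enum.
Qed.

(** * Perturbation of pseudo-inverses *)

Section PseudoInverse.
Context {R : realType} {n : nat}.
Implicit Types A X : 'M[R[i]]_n.

(** [mppinv] is a choice, so a pseudo-inverse has to be exhibited: invert the eigenvalues, with the
    convention that the inverse of 0 is 0. *)
Lemma pinv_exists A : adj A = A -> is_pinv A (mppinv A).
Proof.
move=> hA; rewrite /mppinv; apply: xgetPex.
have [P1 P2] := eigd_spectral _ hA; move: (spectralmx A) (eigval A) P1 P2 => P a P1 P2 E.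
have rs (D1 D2 : 'M[R[i]]_n) :
    (adj P *m D1 *m P) *m (adj P *m D2 *m P) = adj P *m (D1 *m D2) *m P.
  by rewrite !mulmxA -(mulmxA (adj P *m D1)) P1 mulmx1.
pose dg (f : 'I_n -> R) := diag_mx (\row_j (f j)%:C%C) : 'M[R[i]]_n.
have dgM f g : dg f *m dg g = dg (fun j => f j * g j).
  by rewrite mulmx_diag; congr diag_mx; apply/rowP => j; rewrite !mxE rcM.
have dgH f : adj (adj P *m dg f *m P) = adj P *m dg f *m P.
  by rewrite !adjM adjK adj_map_diag mulmxA.
exists (adj P *m dg (fun j => (a j)^-1) *m P).
have dgE f g : f =1 g -> dg f = dg g.
  by move=> fg; congr diag_mx; apply/rowP => j; rewrite !mxE fg.
rewrite E -/(dg a); split.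
- rewrite !rs !dgM; congr (_ *m _ *m _); apply: dgE => j.
  by have [->|aj] := eqVneq (a j) 0; rewrite ?mulr0// mulfV// mul1r.
- rewrite !rs !dgM; congr (_ *m _ *m _); apply: dgE => j.
  by have [->|aj] := eqVneq (a j) 0; rewrite ?invr0 ?mulr0// mulVf// mul1r.
- by rewrite !rs !dgM; apply: dgH.
- by rewrite !rs !dgM; apply: dgH.
Qed.

(** Taking adjoints in A X A = A gives X A A = A and A A X = A, so both products equal X A A X. *)
Lemma pinv_comm A X : adj A = A -> is_pinv A X -> A *m X = X *m A.
Proof.
move=> hA [AXA XAX h1 h2].
have e1 : X *m A *m A = A.
  by have := congr1 adj AXA; rewrite -mulmxA adjM hA [adj (X *m A)]h2.
have e2 : A *m (A *m X) = A.
  by have := congr1 adj AXA; rewrite adjM hA [adj (A *m X)]h1.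
by rewrite -{1}e1 -mulmxA -mulmxA e2.
Qed.

(* The range condition [S *m X *m Sh = Sh] forces both pseudo-inverses to live
   on the same range, where [Sh] is a small perturbation of an invertible map. *)
Lemma pinv_perturbation (S Sh X Xh : 'M[R[i]]_n) (al e : R) :
  adj S = S -> adj Sh = Sh -> is_pinv S X -> is_pinv Sh Xh ->
  S *m X *m Sh = Sh ->
  0 <= al -> (forall y, vnorm (X *m y) <= al * vnorm y) ->
  (forall y, vnorm ((Sh - S) *m y) <= e * vnorm y) -> al * e <= 1 / 2 ->
  (forall y, vnorm (Xh *m y) <= 2 * al * vnorm y) /\
  (forall y, vnorm (Xh *m y - X *m y) <= 2 * al ^+ 2 * e * vnorm y).
Proof.
move=> hS hSh pX pXh ran al0 Xn En ale.
have cS := pinv_comm _ _ hS pX; have cSh := pinv_comm _ _ hSh pXh.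
have [SXS XSX h1 _] := pX; have [ShXSh XShX h1' _] := pXh.
pose Pi := S *m X; pose Pih := Sh *m Xh.
have PiPih : Pi *m Pih = Pih by rewrite /Pih mulmxA ran.
have ShPi : Sh *m Pi = Sh.
  by have := congr1 adj ran; rewrite adjM hSh [adj (S *m X)]h1.
have XE (y : 'cV_n) : X *m (S *m y) = Pi *m y by rewrite mulmxA -cS.
have diff (y : 'cV_n) : Pi *m y = y -> y = X *m (Sh *m y) - X *m ((Sh - S) *m y).
  by move=> {1}<-; rewrite -mulmxBr -mulmxBl opprB addrC subrK XE.
have small y : Pi *m y = y -> vnorm (X *m ((Sh - S) *m y)) <= 1 / 2 * vnorm y.
  move=> _; apply: le_trans (Xn _) _.
  apply: le_trans (ler_wpM2l al0 (En y)) _.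
  by rewrite mulrA ler_wpM2r ?vnorm_ge0.
(* Each column of the difference lies in the range of [Pi] and is killed by [Sh]; [diff] and [small]
   then bound its norm by half of itself. *)
have PiE : Pi = Pih.
  apply/eqP; rewrite -subr_eq0; apply/eqP/matrixP => i j.
  pose y := col j (Pi - Pih).
  have Piy : Pi *m y = y.
    rewrite /y colE mulmxA; congr (_ *m _); rewrite mulmxBr PiPih; congr (_ - _).
    by rewrite /Pi mulmxA SXS.
  have Shy : Sh *m y = 0.
    by rewrite /y colE mulmxA mulmxBr ShPi /Pih cSh mulmxA ShXSh subrr mul0mx.
  have := diff _ Piy; rewrite Shy mulmx0 sub0r => /(congr1 vnorm).
  rewrite vnormN => yE; have := small _ Piy; rewrite -yE => H.
  have y0 : vnorm y = 0 by have := vnorm_ge0 y; lra.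
  rewrite vnormE in y0; have := hnorm_eq0 stdip_inner _ y0.
  by move/colP/(_ i); rewrite !mxE.
have zP (y : 'cV_n) : Pi *m (Xh *m y) = Xh *m y.
  by rewrite PiE /Pih cSh mulmxA XShX.
have zE (y : 'cV_n) : Xh *m y - X *m y = - (X *m ((Sh - S) *m (Xh *m y))).
  have XX : X *m (Sh *m (Xh *m y)) = X *m y.
    by rewrite [Sh *m _]mulmxA -/Pih -PiE /Pi !mulmxA XSX.
  by rewrite {1}(diff _ (zP y)) XX addrAC subrr add0r.
have B1 (y : 'cV_n) : vnorm (Xh *m y) <= 2 * al * vnorm y.
  have := vnormD (Xh *m y - X *m y) (X *m y); rewrite subrK zE vnormN.
  by have := small _ (zP y); have := Xn y; lra.
split=> // y; rewrite zE vnormN; apply: le_trans (Xn _) _.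
have e0 : 0 <= e * vnorm (Xh *m y) by apply: le_trans (En (Xh *m y)); apply: vnorm_ge0.
apply: le_trans (ler_wpM2l al0 (En _)) _.
(* The sign of [e] is not given; it is recovered from [En] as soon as Xh y is nonzero. *)
have [z0|z0] := eqVneq (vnorm (Xh *m y)) 0.
  rewrite z0 !mulr0; have := En y; have := vnorm_ge0 ((Sh - S) *m y) => a b.
  have := le_trans a b; rewrite -mulrA => h.
  by rewrite mulr_ge0// mulr_ge0 ?sqr_ge0.
have e1 : 0 <= e by move: e0; rewrite pmulr_lge0// lt_def z0 vnorm_ge0.
have := ler_wpM2l (mulr_ge0 al0 e1) (B1 y); lra.
Qed.

End PseudoInverse.

(** * Series and frames *)

(** [V] carries no topology, so convergence is stated through the norm alone, as in [series_lim]. *)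
Definition tends {R : realType} {T : zmodType} (nrm : T -> R) (u : nat -> T) (y : T) : Prop :=
  forall e, 0 < e -> exists N0, forall N, (N0 <= N)%N -> nrm (u N - y) < e.

Lemma cvg0_tends {R : realType} {T : zmodType} (nrm : T -> R) (u : nat -> T) (y : T) :
  (forall x, 0 <= nrm x) ->
  ((fun N => nrm (u N - y)) @ \oo --> (0 : R)) <-> tends nrm u y.
Proof.
move=> n0; split=> [/cvgrPdist_lt H e e0|H].
  have [N0 _ HN] := H e e0; exists N0 => N NN.
  by have := HN N NN; rewrite sub0r normrN ger0_norm.
apply/cvgrPdist_lt => e e0; have [N0 HN] := H e e0.
exists N0 => // N /= NN; rewrite sub0r normrN ger0_norm//; exact: HN.
Qed.

(** [series_lim] is a choice with default 0: some limit must be exhibited before its value means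
    anything. *)
Lemma series_lim_tends {R : realType} {T : zmodType} {nrm : T -> R} {f : nat -> T} {y : T} :
  (forall x, 0 <= nrm x) -> tends nrm (fun N => \sum_(j < N) f j) y ->
  tends nrm (fun N => \sum_(j < N) f j) (series_lim nrm f).
Proof.
move=> n0 H; apply/(cvg0_tends nrm) => //.
rewrite /series_lim; apply: (xgetPex 0 (P := [set y | (fun N => nrm (\sum_(j < N) f j - y)) @ \oo --> (0 : R)])).
by exists y; apply/cvg0_tends.
Qed.

Section RealSeries.
Context {R : realType}.
Implicit Types (f g : nat -> R).

Lemma nonneg_series_tends {g} {M : R} : (forall j, 0 <= g j) ->
  (forall N, \sum_(j < N) g j <= M) ->
  exists l, tends (fun x => `|x|) (fun N => \sum_(j < N) g j) l.
Proof.
move=> g0 gM; pose S := [set r | exists N, r = \sum_(j < N) g j].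
have hS : has_sup S.
  by split; [exists 0, 0%N; rewrite big_ord0|exists M => _ [N ->]].
exists (sup S) => e e0; have [_ [N0 ->] HN0] := sup_adherent e0 hS.
exists N0 => N NN; rewrite ler0_norm ?opprB ?subr_le0; last first.
  by apply: ub_le_sup; [case: hS|exists N].
rewrite ltrBlDr -ltrBlDl; apply: lt_le_trans HN0 _.
rewrite -(big_mkord xpredT g) -(big_mkord xpredT g) (big_cat_nat (leq0n _) NN) /=.
by rewrite lerDl; apply: sumr_ge0.
Qed.

(** Reduction to the monotone case by f = (f + g) - g. *)
Lemma abs_series_tends {f g} {M : R} : (forall j, `|f j| <= g j) ->
  (forall N, \sum_(j < N) g j <= M) ->
  exists l, tends (fun x => `|x|) (fun N => \sum_(j < N) f j) l.
Proof.
move=> fg gM.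
have g0 j : 0 <= g j by apply: le_trans (fg j).
have fg0 j : 0 <= f j + g j by have := fg j; rewrite ler_norml => /andP[]; lra.
have fgM N : \sum_(j < N) (f j + g j) <= 2 * M.
  have := gM N; rewrite big_split /=.
  have : \sum_(j < N) f j <= \sum_(j < N) g j.
    by apply: ler_sum => j _; apply: le_trans (ler_norm _) (fg j).
  lra.
have [l1 H1] := nonneg_series_tends fg0 fgM.
have [l2 H2] := nonneg_series_tends g0 gM.
exists (l1 - l2) => e e0; have e2 : 0 < e / 2 by rewrite divr_gt0.
have [N1 HN1] := H1 _ e2; have [N2 HN2] := H2 _ e2.
exists (maxn N1 N2) => N; rewrite geq_max => /andP[NN1 NN2].
have := HN1 _ NN1; have := HN2 _ NN2; rewrite big_split /=.
set a := \sum_(j < N) f j; set b := \sum_(j < N) g j => h1 h2.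
have -> : a - (l1 - l2) = (a + b - l1) - (b - l2) by ring.
by apply: le_lt_trans (ler_normB _ _) _; lra.
Qed.

End RealSeries.

Section ComplexSeries.
Context {R : realType}.

Lemma abs_Re_cabs (z : R[i]) : `|complex.Re z| <= cabs z.
Proof.
rewrite -ler_sqr ?nnegrE ?cabs_ge0// sqr_cabs real_normK ?num_real//.
by rewrite lerDl sqr_ge0.
Qed.

Lemma abs_Im_cabs (z : R[i]) : `|complex.Im z| <= cabs z.
Proof.
rewrite -ler_sqr ?nnegrE ?cabs_ge0// sqr_cabs real_normK ?num_real//.
by rewrite lerDr sqr_ge0.
Qed.

Lemma cabs_le_ReIm (z : R[i]) : cabs z <= `|complex.Re z| + `|complex.Im z|.
Proof.
rewrite -ler_sqr ?nnegrE ?cabs_ge0 ?addr_ge0// sqr_cabs sqrrD.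
rewrite !real_normK ?num_real// /cnorm2 lerD2r lerDl.
by rewrite mulrn_wge0 ?mulr_ge0.
Qed.

Lemma complex_series_tends {f : nat -> R[i]} {g : nat -> R} {M : R} :
  (forall j, cabs (f j) <= g j) -> (forall N, \sum_(j < N) g j <= M) ->
  tends (@cabs R) (fun N => \sum_(j < N) f j) (series_lim (@cabs R) f).
Proof.
move=> fg gM.
have [l1 H1] := abs_series_tends (fun j => le_trans (abs_Re_cabs (f j)) (fg j)) gM.
have [l2 H2] := abs_series_tends (fun j => le_trans (abs_Im_cabs (f j)) (fg j)) gM.
apply: (@series_lim_tends _ _ _ _ (l1 +i* l2)%C) => [|e e0]; first exact: cabs_ge0.
have e2 : 0 < e / 2 by rewrite divr_gt0.
have [N1 HN1] := H1 _ e2; have [N2 HN2] := H2 _ e2.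
exists (maxn N1 N2) => N; rewrite geq_max => /andP[NN1 NN2].
have := HN1 _ NN1; have := HN2 _ NN2; rewrite -Re_sum -Im_sum.
case: (\sum_(j < N) f j) => a b /= h2 h1.
by apply: le_lt_trans (cabs_le_ReIm _) _ => /=; lra.
Qed.

Lemma cnorm2_mul_le (a b : R[i]) : cabs (a * b) <= cnorm2 a + cnorm2 b.
Proof.
have -> : cabs (a * b) = cabs a * cabs b.
  by apply/eqP; rewrite -(@eqrXn2 _ 2) ?mulr_ge0 ?cabs_ge0// exprMn !sqr_cabs cnorm2M.
rewrite -!sqr_cabs; have := sqr_ge0 (cabs a - cabs b); rewrite sqrrB.
have := sqr_ge0 (cabs a); have := sqr_ge0 (cabs b); lra.
Qed.

Lemma l2ip_tends {a b : nat -> R[i]} {A B : R} :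
  (forall N, \sum_(j < N) cnorm2 (a j) <= A) ->
  (forall N, \sum_(j < N) cnorm2 (b j) <= B) ->
  tends (@cabs R) (fun N => \sum_(j < N) a j * conjc (b j)) (l2ip a b).
Proof.
move=> aA bB; apply: (@complex_series_tends _ (fun j => cnorm2 (a j) + cnorm2 (b j)) (A + B)).
  by move=> j; apply: le_trans (cnorm2_mul_le _ _) _; rewrite cnorm2_conj.
by move=> N; rewrite big_split lerD.
Qed.

Lemma tends_col {n} {u : nat -> 'cV[R[i]]_n} {y : 'cV[R[i]]_n} :
  (forall k, tends (@cabs R) (fun N => u N k 0) (y k 0)) -> tends (@vnorm R n) u y.
Proof.
move=> H e e0.
(* Dividing by n + 1 covers n = 0 and keeps the total n e / (n + 1) strictly below e. *)
have e1 : 0 < e / n.+1%:R by rewrite divr_gt0// ltr0n.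
have /choice[N0 HN0] : forall k, exists N0, forall N, (N0 <= N)%N ->
    cabs (u N k 0 - y k 0) < e / n.+1%:R by move=> k; apply: H.
exists (\max_k N0 k) => N NN.
have NNk k : (N0 k <= N)%N by apply: leq_trans NN; apply: leq_bigmax.
apply: (@le_lt_trans _ _ (\sum_k cabs (u N k 0 - y k 0))).
  rewrite -ler_sqr ?nnegrE ?vnorm_ge0 ?sumr_ge0//; last by move=> *; apply: cabs_ge0.
  rewrite sqr_vnorm /fro; under eq_bigr do rewrite big_ord1 !mxE -sqr_cabs.
  suff [] : 0 <= \sum_k cabs (u N k 0 - y k 0) /\
      \sum_k cabs (u N k 0 - y k 0) ^+ 2 <= (\sum_k cabs (u N k 0 - y k 0)) ^+ 2 by [].
  elim/big_rec2: _ => [|k s t _ [t0 IH]]; first by rewrite expr0n.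
  have h := cabs_ge0 (u N k 0 - y k 0).
  rewrite addr_ge0//; split=> //; rewrite sqrrD.
  by have := mulr_ge0 h t0; rewrite mulr2n; lra.
apply: (@le_lt_trans _ _ (\sum_(k < n) e / n.+1%:R)).
  by apply: ler_sum => k _; apply: ltW; apply: HN0.
rewrite sumr_const card_ord -[_ *+ n]mulr_natl mulrCA -[ltRHS]mulr1 ltr_pM2l//.
by rewrite ltr_pdivrMr ?ltr0n// mul1r ltr_nat.
Qed.

End ComplexSeries.

Section FrameFacts.
Context {R : realType} {V : lmodType R[i]} {ip : V -> V -> R[i]}.
Context (HI : is_inner_product ip).

(* The frame inequality is assumed on the closed span only; testing it on the
   partial sum [y] of the frame operator gives Bessel for every [x] without
   projecting onto the span. *)
Lemma frame_bessel {f : nat -> V} {A B : R} : frame_bounds ip f A B ->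
  forall N x, \sum_(j < N) cnorm2 (ip x (f j)) <= B * hnorm ip x ^+ 2.
Proof.
move=> [A0 AB Hf] N x; have B0 : 0 <= B by apply: ltW; apply: lt_le_trans AB.
pose c (j : 'I_N) := ip x (f j).
pose y := \sum_(j < N) c j *: f j.
pose S := \sum_(j < N) cnorm2 (c j).
have S0 : 0 <= S by apply: sumr_ge0 => j _; apply: cnorm2_ge0.
have ysp : cspan ip f y.
  move=> e e0; exists N, (fun j => if insub j is Some k then c k else 0).
  rewrite (_ : y - _ = 0) ?hnorm0//.
  apply/eqP; rewrite subr_eq0; apply/eqP; apply: eq_bigr => j _.
  by rewrite valK.
have By : \sum_(j < N) cnorm2 (ip y (f j)) <= B * hnorm ip y ^+ 2.
  rewrite -lee_fin; have [_] := Hf y ysp; apply: le_trans.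
  have := @nneseries_lim_ge R (fun k => (cnorm2 (ip y (f k)))%:E) xpredT 0%N N.
  rewrite big_mkord sumEFin; apply => k _ _.
  by rewrite lee_fin cnorm2_ge0.
have yS : hnorm ip y ^+ 2 <= B * S by apply: (synthesis_bound HI B0 By).
have xy : ip x y = S%:C%C.
  rewrite /y (ip_sumr HI) /S rc_sum; apply: eq_bigr => j _.
  by rewrite (ipZr HI) mulrC mul_conjc.
have := cauchy_schwarz HI x y; rewrite xy cnorm2_real => CS.
have [S00|S00] := eqVneq S 0; first by rewrite -/S S00 mulr_ge0 ?sqr_ge0.
have Sp : 0 < S by rewrite lt_def S00.
have := le_trans CS (ler_wpM2l (sqr_ge0 (hnorm ip x)) yS).
move=> H; suff : S <= B * hnorm ip x ^+ 2 by [].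
rewrite -(ler_pM2r Sp) -expr2; apply: le_trans H _.
by rewrite le_eqVlt; apply/orP; left; apply/eqP; rewrite mulrCA mulrA.
Qed.

(** Gram-Schmidt by induction: w_n is replaced by its residual z, which may be 0, so linear
    independence is not assumed. *)
Lemma orthogonal_projection (w : nat -> V) (n : nat) (x : V) :
  exists y, (forall k, (k < n)%N -> ip y (w k) = 0) /\
            exists c : nat -> R[i], x - y = \sum_(k < n) c k *: w k.
Proof.
elim: n x => [|n IH] x.
  by exists x; split=> //; exists (fun=> 0); rewrite subrr big_ord0.
have [y [yw [c cE]]] := IH x.
have [z [zw [d dE]]] := IH (w n).
have wz : w n = z + \sum_(k < n) d k *: w k by rewrite -dE addrC subrK.
have perp v : (forall k, (k < n)%N -> ip v (w k) = 0) -> ip v (w n) = ip v z.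
  move=> vw; rewrite wz (ipDr HI) (ip_sumr HI) big1 ?addr0// => k _.
  by rewrite (ipZr HI) vw ?mulr0.
have [z0|z0] := eqVneq z 0.
  exists y; split=> [k|].
    rewrite ltnS leq_eqVlt => /predU1P[->|/yw//].
    by rewrite perp// z0 (ip0r HI).
  exists (fun k => if (k < n)%N then c k else 0).
  rewrite cE big_ord_recr /= ltnn scale0r addr0.
  by apply: eq_bigr => k _; rewrite ltn_ord.
pose t := ip y z / ip z z.
have zz : ip z z != 0.
  by apply: contraNneq z0 => zz0; case: HI => _ _ _ h; apply/eqP/h.
exists (y - t *: z); split=> [k|].
  have h j : (j < n)%N -> ip (y - t *: z) (w j) = 0.
    by move=> jn; rewrite (ipBl HI) (ipZl HI) yw// zw// mulr0 subrr.
  rewrite ltnS leq_eqVlt => /predU1P[->|/h//].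
  by rewrite perp// (ipBl HI) (ipZl HI) /t divfK// subrr.
exists (fun k => if (k < n)%N then c k - t * d k else t).
rewrite big_ord_recr /= ltnn wz scalerDr scaler_sumr.
rewrite (eq_bigr (fun k : 'I_n => c k *: w k - t *: (d k *: w k))) => [|k _].
  by rewrite sumrB -cE addrACA addNr addr0 opprB addrAC addrA.
by rewrite ltn_ord scalerBl scalerA.
Qed.

End FrameFacts.

(** * Operator and matrix norms as suprema *)

Section OperatorNorm.
Context {R : realType} {X Y : Type} {nx : X -> R} {ny : Y -> R}.
Implicit Types f g : X -> Y.

(** [sup] is an upper bound only for a bounded set, hence the explicit bound [M]; the reverse
    estimate needs nonemptiness, hence a witness x there. *)
Lemma le_opnorm {f} {M : R} {x : X} :
  (forall z, nx z <= 1 -> ny (f z) <= M) -> nx x <= 1 -> ny (f x) <= opnorm nx ny f.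
Proof.
move=> fM x1; apply: ub_le_sup; last by exists x.
by exists M => _ [z [z1 ->]]; apply: fM.
Qed.

Lemma opnorm_le {f} {M : R} {x : X} : nx x <= 1 ->
  (forall z, nx z <= 1 -> ny (f z) <= M) -> opnorm nx ny f <= M.
Proof.
move=> x1 fM; apply: ge_sup; first by exists (ny (f x)), x.
by move=> _ [z [z1 ->]]; apply: fM.
Qed.

Lemma opnorm_dist {f g} {M d : R} {x : X} : nx x <= 1 ->
  (forall z, nx z <= 1 -> ny (f z) <= M) ->
  (forall z, nx z <= 1 -> `|ny (g z) - ny (f z)| <= d) ->
  `|opnorm nx ny g - opnorm nx ny f| <= d.
Proof.
move=> x1 fM gf.
have gM z : nx z <= 1 -> ny (g z) <= M + d.
  by move=> z1; have := fM z z1; have := ler_normlP _ _ (gf z z1) => -[]; lra.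
rewrite ler_norml; apply/andP; split.
  rewrite lerBrDr addrC -lerBrDr opprK; apply: (opnorm_le x1) => z z1.
  by have := le_opnorm gM z1; have := ler_normlP _ _ (gf z z1) => -[]; lra.
rewrite lerBlDr; apply: (opnorm_le x1) => z z1.
by have := le_opnorm fM z1; have := ler_normlP _ _ (gf z z1) => -[]; lra.
Qed.

End OperatorNorm.

Section MatrixNorm.
Context {R : realType} {n : nat}.
Implicit Types (A : 'M[R[i]]_n) (x : 'cV[R[i]]_n).

Lemma vnorm0 : vnorm (0 : 'cV[R[i]]_n) = 0.
Proof. by rewrite vnormE (hnorm0 stdip_inner). Qed.

Lemma vnorm_mulmx_fro A x : vnorm (A *m x) <= Num.sqrt (fro A) * vnorm x.
Proof.
rewrite -ler_sqr ?nnegrE ?mulr_ge0 ?vnorm_ge0 ?sqrtr_ge0//.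
rewrite exprMn !sqr_vnorm sqr_sqrtr ?fro_ge0// [fro (A *m x)]fro_row [fro A]fro_row.
rewrite mulr_suml; apply: ler_sum => i _; rewrite row_mul.
by rewrite {1}/fro !big_ord1 cauchy_schwarz_mx.
Qed.

(** A crude bound that makes the supremum in [mxnorm] meaningful. *)
Lemma mxnorm_bounded A z : vnorm z <= 1 -> vnorm (A *m z) <= Num.sqrt (fro A).
Proof.
move=> z1; apply: le_trans (vnorm_mulmx_fro _ _) _.
by rewrite ler_piMr ?sqrtr_ge0.
Qed.

Lemma mxnorm_ge0 A : 0 <= mxnorm A.
Proof.
apply: le_trans (le_opnorm (mxnorm_bounded A) (_ : vnorm 0 <= 1)).
  exact: vnorm_ge0.
by rewrite vnorm0.
Qed.

Lemma vnorm_mulmx A x : vnorm (A *m x) <= mxnorm A * vnorm x.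
Proof.
have [x0|x0] := eqVneq (vnorm x) 0.
  rewrite vnormE in x0; rewrite (hnorm_eq0 stdip_inner _ x0) mulmx0 vnorm0 mulr0//.
have xp : 0 < vnorm x by rewrite lt_def x0 vnorm_ge0.
have cabsV : cabs ((vnorm x)^-1)%:C%C = (vnorm x)^-1.
  by rewrite /cabs cnorm2_real sqrtr_sqr ger0_norm// invr_ge0 ltW.
have := le_opnorm (mxnorm_bounded A) (_ : vnorm (((vnorm x)^-1)%:C%C *: x) <= 1).
rewrite -scalemxAr !vnormZ cabsV mulVf// => /(_ (lexx _)).
by rewrite mulrC ler_pdivrMr.
Qed.

Lemma mulmx_ext (A B : 'M[R[i]]_n) : (forall x : 'cV_n, A *m x = B *m x) -> A = B.
Proof.
move=> AB; apply/matrixP => i j; have := AB (delta_mx j 0).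
by rewrite -!colE => /colP/(_ i); rewrite !mxE.
Qed.

End MatrixNorm.

Section ComplexLimits.
Context {R : realType}.

Lemma cabs_vnorm (z : R[i]) : cabs z = vnorm (\col_(k < 1) z).
Proof. by rewrite /vnorm big_ord1 mxE. Qed.

Lemma cabsD (a b : R[i]) : cabs (a + b) <= cabs a + cabs b.
Proof.
rewrite !cabs_vnorm; apply: le_trans (vnormD _ _); rewrite le_eqVlt; apply/orP; left.
by apply/eqP; congr vnorm; apply/colP => k; rewrite !mxE.
Qed.

Lemma cabsM (a b : R[i]) : cabs (a * b) = cabs a * cabs b.
Proof.
by apply/eqP; rewrite -(@eqrXn2 _ 2) ?mulr_ge0 ?cabs_ge0// exprMn !sqr_cabs cnorm2M.
Qed.

Lemma cabs_conj (a : R[i]) : cabs (conjc a) = cabs a.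
Proof. by rewrite /cabs cnorm2_conj. Qed.

Lemma tends_cabs_unique {u : nat -> R[i]} {y z : R[i]} :
  tends (@cabs R) u y -> tends (@cabs R) u z -> y = z.
Proof.
move=> uy uz; apply/eqP; rewrite -subr_eq0; apply/eqP/cnorm2_eq0.
rewrite -sqr_cabs; suff -> : cabs (y - z) = 0 by rewrite expr0n.
apply/eqP; rewrite eq_le cabs_ge0 andbT; apply/ler_addgt0Pr => e e0.
have e2 : 0 < e / 2 by rewrite divr_gt0.
have [N1 H1] := uy _ e2; have [N2 H2] := uz _ e2.
have := H1 _ (leq_maxl N1 N2); have := H2 _ (leq_maxr N1 N2).
set t := u _ => h2 h1.
have -> : y - z = - (t - y) + (t - z) by ring.
have cN a : cabs (- a) = cabs a :> R by rewrite /cabs cnorm2N.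
by apply: le_trans (cabsD _ _) _; rewrite cN; lra.
Qed.

Lemma tends_conj {u : nat -> R[i]} {y} :
  tends (@cabs R) u y -> tends (@cabs R) (fun N => conjc (u N)) (conjc y).
Proof.
move=> H e e0; have [N0 HN] := H e e0; exists N0 => N NN.
by rewrite -rmorphB cabs_conj; apply: HN.
Qed.

Lemma tends_sum {I : finType} {a : I -> R[i]} {u : I -> nat -> R[i]} {y : I -> R[i]} :
  (forall i, tends (@cabs R) (u i) (y i)) ->
  tends (@cabs R) (fun N => \sum_i a i * u i N) (\sum_i a i * y i).
Proof.
move=> H e e0.
pose S := \sum_i cabs (a i); have S0 : 0 <= S by apply: sumr_ge0 => i _; apply: cabs_ge0.
have e1 : 0 < e / (S + 1) by rewrite divr_gt0// ltr_wpDl.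
have /choice[N0 HN0] : forall i, exists N0, forall N, (N0 <= N)%N ->
    cabs (u i N - y i) < e / (S + 1) by move=> i; apply: H.
exists (\max_i N0 i) => N NN.
have NNi i : (N0 i <= N)%N by apply: leq_trans NN; apply: leq_bigmax.
apply: (@le_lt_trans _ _ (\sum_i cabs (a i) * (e / (S + 1)))).
  rewrite -sumrB; apply: (@le_trans _ _ (\sum_i cabs (a i * u i N - a i * y i))).
    elim/big_rec2: _ => [|i z t _ IH]; first by rewrite /cabs cnorm20 sqrtr0.
    by apply: le_trans (cabsD _ _) _; rewrite lerD2l.
  apply: ler_sum => i _; rewrite -mulrBr cabsM.
  by apply: ler_wpM2l; [apply: cabs_ge0|apply/ltW/HN0].
rewrite -mulr_suml -/S mulrCA -[ltRHS]mulr1 ltr_pM2l//.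
by rewrite ltr_pdivrMr ?mul1r ?ltrDl// ltr_wpDl.
Qed.

End ComplexLimits.

Section HilbertLimits.
Context {R : realType} {V : lmodType R[i]} {ip : V -> V -> R[i]}.
Context (HI : is_inner_product ip).

Lemma hnorm_dist (x y : V) : `|hnorm ip x - hnorm ip y| <= hnorm ip (x - y).
Proof.
rewrite ler_norml; apply/andP; split.
  by have := hnormD HI (- (x - y)) x; rewrite (hnormN HI) opprB subrK; lra.
by have := hnormD HI (x - y) y; rewrite subrK; lra.
Qed.

Lemma tends_hnorm_le {u : nat -> V} {y : V} {M : R} :
  (forall N, hnorm ip (u N) <= M) -> tends (hnorm ip) u y -> hnorm ip y <= M.
Proof.
move=> uM uy; apply/ler_addgt0Pr => e e0; have [N0 HN] := uy e e0.
have := HN _ (leqnn _); have := uM N0.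
have := hnormD HI (u N0) (- (u N0 - y)); rewrite (hnormN HI) opprB addrC subrK.
lra.
Qed.

Lemma hilbert_series_tends {f : nat -> V} {g : nat -> R} {M : R} :
  hcomplete ip -> (forall j, hnorm ip (f j) <= g j) ->
  (forall N, \sum_(j < N) g j <= M) ->
  tends (hnorm ip) (fun N => \sum_(j < N) f j) (series_lim (hnorm ip) f).
Proof.
move=> HC fg gM.
have g0 j : 0 <= g j by apply: le_trans (fg j); apply: hnorm_ge0.
have [l Hl] := nonneg_series_tends g0 gM.
have inc a b : (a <= b)%N ->
    hnorm ip (\sum_(j < b) f j - \sum_(j < a) f j) <= \sum_(j < b) g j - \sum_(j < a) g j.
  move=> ab; rewrite -!(big_mkord xpredT f) -!(big_mkord xpredT g).
  rewrite !(big_cat_nat (leq0n _) ab) /= ![_ + _ - _]addrAC !subrr !add0r.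
  by apply: le_trans (hnorm_sum HI _ _ _ _) _; apply: ler_sum.
have [|y Hy] := HC (fun N => \sum_(j < N) f j).
  move=> e e0; have e2 : 0 < e / 2 by rewrite divr_gt0.
  have [N0 HN] := Hl _ e2; exists N0.
  have half a b : (N0 <= a)%N -> (N0 <= b)%N -> \sum_(j < b) g j - \sum_(j < a) g j < e.
    move=> /HN; rewrite ltr_norml => /andP[? ?] /HN; rewrite ltr_norml => /andP[? ?].
    lra.
  move=> a b Na Nb; have [ab|ba] := leqP a b.
    rewrite -(hnormN HI) opprB; apply: le_lt_trans (inc _ _ ab) _; exact: half.
  by apply: le_lt_trans (inc _ _ (ltnW ba)) _; apply: half.
apply: (series_lim_tends (hnorm_ge0)) => //.
by apply/cvg0_tends; [exact: hnorm_ge0|exact: Hy].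
Qed.

(* [y] is the value at [x] of the frame operator of [u]. *)
Lemma frame_operator_energy {u : nat -> V} {x y : V} N :
  tends (hnorm ip) (fun M => \sum_(j < M) ip x (u j) *: u j) y ->
  \sum_(j < N) cnorm2 (ip x (u j)) <= hnorm ip y * hnorm ip x.
Proof.
move=> uy; apply/ler_addgt0Pr => e e0.
have h0 := hnorm_ge0 (ip := ip) x.
have e1 : 0 < e / (hnorm ip x + 1) by rewrite divr_gt0// ltr_wpDl.
have [N0 HN] := uy _ e1; pose M := maxn N0 N.
have := HN M (leq_maxl _ _); set z := \sum_(j < M) _ => Hz.
have zx : complex.Re (ip z x) = \sum_(j < M) cnorm2 (ip x (u j)).
  rewrite /z (ip_suml HI) Re_sum; apply: eq_bigr => j _.
  by rewrite (ipZl HI) (ipC HI x (u j)) mul_conjc.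
apply: (@le_trans _ _ (\sum_(j < M) cnorm2 (ip x (u j)))).
  rewrite -(big_mkord xpredT (fun j => cnorm2 (ip x (u j)))).
  rewrite -(big_mkord xpredT (fun j => cnorm2 (ip x (u j)))).
  rewrite (big_cat_nat (leq0n _) (leq_maxr N0 N)) /= lerDl.
  by apply: sumr_ge0 => j _; apply: cnorm2_ge0.
rewrite -zx; apply: le_trans (ler_norm _) _; apply: le_trans (abs_Re_cabs _) _.
apply: le_trans (cabs_ip HI _ _) _.
have zy : hnorm ip z <= hnorm ip y + e / (hnorm ip x + 1).
  by have := hnormD HI (z - y) y; rewrite subrK; lra.
apply: le_trans (ler_wpM2r h0 zy) _; rewrite mulrDl lerD2l.
rewrite -mulrA ler_piMr ?(ltW e0)// mulrC ler_pdivrMr ?mul1r ?ltr_wpDl//.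
by rewrite lerDl.
Qed.

(** <T x, x> is the sum of the |<x, u_j>|^2, so a bound for [T] on the unit ball becomes a Bessel
    bound. Used for [Top] on [V] and for [Sigma] on C^n, whence the maximum in [Kcst]. *)
Lemma frame_operator_bessel {u : nat -> V} {T : V -> V} {tau : R} :
  (forall x, hnorm ip x <= 1 -> hnorm ip (T x) <= tau) ->
  (forall x, tends (hnorm ip) (fun M => \sum_(j < M) ip x (u j) *: u j) (T x)) ->
  forall N x, \sum_(j < N) cnorm2 (ip x (u j)) <= tau * hnorm ip x ^+ 2.
Proof.
move=> Tt uT N x.
have [x0|x0] := eqVneq (hnorm ip x) 0.
  rewrite (hnorm_eq0 HI _ x0) (hnorm0 HI) expr0n mulr0 big1// => j _.
  by rewrite (ip0l HI) cnorm20.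
have xp : 0 < hnorm ip x by rewrite lt_def x0 hnorm_ge0.
pose x' := ((hnorm ip x)^-1)%:C%C *: x.
have x'1 : hnorm ip x' = 1 by rewrite (hnormZ_real HI) ?invr_ge0 ?hnorm_ge0// mulVf.
have x'le : hnorm ip x' <= 1 by rewrite x'1.
have := frame_operator_energy N (uT x'); rewrite x'1 mulr1 => H.
have {}H := le_trans H (Tt x' x'le).
have E : \sum_(j < N) cnorm2 (ip x' (u j)) =
    (hnorm ip x)^-1 ^+ 2 * \sum_(j < N) cnorm2 (ip x (u j)).
  rewrite mulr_sumr; apply: eq_bigr => j _.
  by rewrite (ipZl HI) cnorm2M cnorm2_real.
by rewrite E exprVn mulrC ler_pdivrMr ?exprn_gt0// in H.
Qed.

End HilbertLimits.

(** * The sampled operators *)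

Section FrameOperators.
Context {R : realType} {V : lmodType R[i]} {ip : V -> V -> R[i]}.
Context (HI : is_inner_product ip).
Context {s w : nat -> V} {Bs Bw : R} {n : nat}.
Context (Bess : forall N x, \sum_(j < N) cnorm2 (ip x (s j)) <= Bs * hnorm ip x ^+ 2).

Notation PW := (projWnperp ip w n).
Notation v := (vvec ip s w n).
Notation u := (uvec ip s w n).

Lemma projWnperpP x : (forall k : 'I_n, ip (PW x) (w k) = 0) /\
  exists c : 'I_n -> R[i], x - PW x = \sum_(k < n) c k *: w k.
Proof.
rewrite /projWnperp; apply: (xgetPex 0 (P := [set y | (forall k : 'I_n, ip y (w k) = 0) /\
                  exists c : 'I_n -> R[i], x - y = \sum_(k < n) c k *: w k])).
have [y [yw [c E]]] := orthogonal_projection HI w n x.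
by exists y; split=> [k|]; [apply: yw|exists (fun k => c k)].
Qed.

(** Moves the projection from x onto s_j, turning the coefficients of [Gamma] into <x, u_j>. *)
Lemma projWnperp_sym x y : ip (PW x) y = ip x (PW y).
Proof.
have [xw [c xE]] := projWnperpP x; have [yw [d yE]] := projWnperpP y.
transitivity (ip (PW x) (PW y)).
  rewrite -{1}(subrK (PW y) y) yE (ipDr HI) (ip_sumr HI) big1 ?add0r// => k _.
  by rewrite (ipZr HI) xw mulr0.
rewrite -{2}(subrK (PW x) x) xE (ipDl HI) (ip_suml HI) big1 ?add0r// => k _.
by rewrite (ipZl HI) (ipC HI (PW y)) yw conjc0 mulr0.
Qed.

Lemma Ue_bounded l N : \sum_(j < N) cnorm2 (Ue ip s w l j) <= Bs * hnorm ip (w l) ^+ 2.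
Proof. exact: Bess. Qed.

Lemma vvecE j k : v j k 0 = conjc (Ue ip s w k j).
Proof. by rewrite mxE /Ue -(ipC HI). Qed.

Lemma Gamma_tends x :
  tends (@vnorm R n) (fun N => \sum_(j < N) ip x (u j) *: v j) (Gamma ip s w n x).
Proof.
apply: tends_col => k; rewrite mxE.
rewrite [X in tends _ X](_ : _ =
  (fun N => \sum_(j < N) ip (PW x) (s j) * conjc (Ue ip s w k j))).
  by apply: l2ip_tends => N; apply: Bess.
apply/funext => N; rewrite summxE; apply: eq_bigr => j _.
by rewrite mxE vvecE projWnperp_sym.
Qed.

(** [Sigma] is the frame operator of the v_j on C^n; this puts it in the same form as [Gamma], with
    u_j = v_j. *)
Lemma Sigma_tends x :
  tends (@vnorm R n) (fun N => \sum_(j < N) stdip x (v j) *: v j) (Sigma ip s w n *m x).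
Proof.
apply: tends_col => k; rewrite mxE.
rewrite [X in tends _ X](_ : _ = (fun N => \sum_l x l 0 *
    \sum_(j < N) Ue ip s w l j * conjc (Ue ip s w k j))).
  under eq_bigr do rewrite mulrC.
  apply: tends_sum => l; rewrite mxE; apply: l2ip_tends => N; exact: Ue_bounded.
apply/funext => N; rewrite summxE.
under [RHS]eq_bigr do rewrite mulr_sumr.
rewrite exchange_big; apply: eq_bigr => j _.
rewrite mxE /stdip mulr_suml; apply: eq_bigr => l _.
by rewrite !vvecE conjcK mulrA.
Qed.

Lemma Sigma_adj : adj (Sigma ip s w n) = Sigma ip s w n.
Proof.
apply/matrixP => k l; rewrite adjE !mxE.
have T a b := l2ip_tends (Ue_bounded a) (Ue_bounded b).
apply: (tends_cabs_unique _ (T l k)).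
have := tends_conj (T k l).
rewrite [X in tends _ X](_ : _ = (fun N => \sum_(j < N) Ue ip s w l j * conjc (Ue ip s w k j))) //.
by apply/funext => N; rewrite conjc_sum; apply: eq_bigr => j _; rewrite conjcM conjcK mulrC.
Qed.

Lemma Sigma_hat_adj p m (i : {ffun 'I_m -> nat}) :
  adj (Sigma_hat ip s w n p i) = Sigma_hat ip s w n p i.
Proof.
apply/matrixP => k l; rewrite adjE !mxE /qip conjcM conjc_inv conjc_nat.
congr (_ * _); rewrite conjc_sum; apply: eq_bigr => t _.
by rewrite !conjcM conjcK conjc_real mulrAC.
Qed.

Lemma invC_nat (m : nat) : ((m%:R)^-1 : R[i]) = ((m%:R)^-1 : R)%:C%C.
Proof. by rewrite -[in LHS](rmorph_nat (real_complex R)) -fmorphV. Qed.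

Lemma Sigma_hat_mul p m (i : {ffun 'I_m -> nat}) x :
  Sigma_hat ip s w n p i *m x = sample_mean (ip := stdip) v v p i x.
Proof.
apply/colP => k; rewrite !mxE summxE mulr_sumr.
under eq_bigr do rewrite mxE /qip mulr_sumr mulr_suml.
rewrite exchange_big; apply: eq_bigr => t _; rewrite mxE /stdip invC_nat.
rewrite mulr_sumr mulr_suml mulr_sumr; apply: eq_bigr => l _.
by rewrite !vvecE conjcK; ring.
Qed.

Lemma Gamma_hatE p m (i : {ffun 'I_m -> nat}) x :
  Gamma_hat ip s w n p i x = sample_mean (ip := ip) v u p i x.
Proof.
apply/colP => k; rewrite !mxE summxE /qip invC_nat; congr (_ * _).
by apply: eq_bigr => t _; rewrite mxE vvecE projWnperp_sym.
Qed.

(** The residual z is killed by [Sigma], so by the energy inequality it is orthogonal to v_j; it is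
    also orthogonal to the range of [Sigma]. Hence <z, z> = 0. *)
Lemma Sigma_range X j : is_pinv (Sigma ip s w n) X -> Sigma ip s w n *m X *m v j = v j.
Proof.
move=> pX; set S := Sigma ip s w n in pX *.
have cS := pinv_comm _ _ Sigma_adj pX; have [SXS _ h1 _] := pX.
set z := v j - S *m X *m v j.
have Sz : S *m z = 0.
  by rewrite /z mulmxBr !mulmxA -(mulmxA S) cS mulmxA SXS subrr.
have : cnorm2 (stdip z (v j)) = 0.
  apply/eqP; rewrite eq_le cnorm2_ge0 andbT.
  have T := Sigma_tends z; rewrite -/S Sz in T.
  have := @frame_operator_energy _ _ _ stdip_inner v z 0 j.+1 _.
  rewrite (hnorm0 stdip_inner) mul0r => H; apply: le_trans (H _).
    rewrite big_ord_recr /= lerDr; apply: sumr_ge0 => k _; exact: cnorm2_ge0.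
  by move=> e e0; have [N0 HN] := T e e0; exists N0 => N NN; rewrite -vnormE; apply: HN.
move/cnorm2_eq0 => zv.
have z0 : stdip z z = 0.
  rewrite {2}/z (ipDr stdip_inner) zv add0r -mulNmx -mulmxN stdipE.
  by rewrite !adjM Sigma_adj -!mulmxA Sz !mulmx0 mxE.
have [_ _ _ /(_ z z0)/eqP] := @stdip_inner R n.
by rewrite subr_eq0 => /eqP.
Qed.

Lemma Sigma_range_hat X p m (i : {ffun 'I_m -> nat}) : is_pinv (Sigma ip s w n) X ->
  Sigma ip s w n *m X *m Sigma_hat ip s w n p i = Sigma_hat ip s w n p i.
Proof.
move=> pX; apply: mulmx_ext => x; rewrite -mulmxA Sigma_hat_mul /sample_mean.
rewrite -scalemxAr mulmx_sumr; congr (_ *: _); apply: eq_bigr => t _.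
by rewrite -scalemxAr Sigma_range.
Qed.

Lemma Wn_bounded : 0 <= Bw ->
  (forall N x, \sum_(j < N) cnorm2 (ip x (w j)) <= Bw * hnorm ip x ^+ 2) ->
  forall c : 'cV_n, hnorm ip (Wn w c) <= Num.sqrt Bw * vnorm c.
Proof.
move=> B0 Bw' c.
rewrite -ler_sqr ?nnegrE ?hnorm_ge0 ?mulr_ge0 ?sqrtr_ge0 ?vnorm_ge0//.
rewrite [leRHS]exprMn sqr_vnorm (sqr_sqrtr B0).
rewrite (_ : fro c = \sum_(k < n) cnorm2 (c k 0)).
  rewrite /Wn; apply: (@synthesis_bound _ _ _ HI n (fun k => w k) Bw (fun k => c k 0) B0 (Bw' n _)).
by rewrite /fro; apply: eq_bigr => k _; rewrite big_ord1.
Qed.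

Lemma WnB (c d : 'cV_n) : Wn w (c - d) = Wn w c - Wn w d.
Proof. by rewrite /Wn -sumrB; apply: eq_bigr => k _; rewrite !mxE scalerBl. Qed.

End FrameOperators.

(** * Union bound and final estimate *)

Lemma bernoulli_le {R : realType} (x : R) m : 0 <= x -> x <= 1 -> 1 - m%:R * x <= (1 - x) ^+ m.
Proof.
move=> x0 x1; elim: m => [|m IH]; first by rewrite mul0r subr0 expr0.
have x10 : 0 <= 1 - x by lra.
rewrite exprS; apply: le_trans (ler_wpM2l x10 IH).
have : 0 <= m%:R * x * x by rewrite !mulr_ge0.
by rewrite -natr1; nra.
Qed.

Theorem theorem3p12
  (R : realType) (V : lmodType R[i]) (ip : V -> V -> R[i])
  (HH : is_hilbert ip)
  (s w : nat -> V) (Cb Db : R)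
  (Hs : is_frame ip s) (Hw : frame_bounds ip w Cb Db)
  (n : nat) (p : nat -> R)
  (Hp0 : forall j, 0 <= p j) (Hp1 : (\sum_(j <oo) (p j)%:E = 1)%E)
  (* (A)(i) : W intersected with S^perp is {0} *)
  (HAi : forall x, cspan ip w x -> (forall y, cspan ip s y -> ip x y = 0) -> x = 0)
  (* (A)(ii) : R < oo and R' < oo *)
  (HAii : exists M : R, forall j, 0 < p j -> vnorm (vvec ip s w n j) ^+ 2 / p j <= M)
  (HAii' : exists M : R, forall j, 0 < p j -> hnorm ip (uvec ip s w n j) ^+ 2 / p j <= M)
  (* (A)(iii) : p_j > 0 whenever v_j <> 0 *)
  (HAiii : forall j, vvec ip s w n j != 0 -> 0 < p j)
  (HSig : Sigma ip s w n != 0)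
  (eps delta : R)
  (Heps : 0 < eps)
  (Heps' : eps < (1 + mxnorm (mppinv (Sigma ip s w n))
                    + opnorm (hnorm ip) (@vnorm R n) (Gamma ip s w n))
                 * Num.sqrt Db * Num.min 1 (2 * mxnorm (mppinv (Sigma ip s w n))))
  (Hdelta : 0 < delta) (Hdelta' : delta < 1)
  (m : nat)
  (Hm : let Lam := 1 + mxnorm (mppinv (Sigma ip s w n))
                     + opnorm (hnorm ip) (@vnorm R n) (Gamma ip s w n) in
        let K := Kcst ip s w n p in
        let R'' := Rcst'' ip s w n p in
        Num.max (Mtilde K R'' n (eps / (Lam * Num.sqrt Db)) (delta / 2))
                (Mtilde K R'' n
                   (eps / (4 * mxnorm (mppinv (Sigma ip s w n)) ^+ 2 * Lam * Num.sqrt Db))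
                   (delta / 2))
        <= m%:R) :
  ((1 - delta)%:E <=
     iid_prob p [set i : {ffun 'I_m -> nat} |
                  (`|K_Omega ip s w n p i - Ktrue ip s w n| < eps)%R])%E.
Proof.
have [HI HC _] := HH.
have [As [Bs Fs]] := Hs.
have Bess := frame_bessel HI Fs.
set S := Sigma ip s w n in HSig Heps' Hm *.
set X := mppinv S in Heps' Hm *.
set a := mxnorm X in Heps' Hm *.
set g := opnorm (hnorm ip) (@vnorm R n) (Gamma ip s w n) in Heps' Hm *.
set Lam := 1 + a + g in Heps' Hm *.
set K := Kcst ip s w n p in Hm *; set Rr := Rcst'' ip s w n p in Hm *.
pose v := vvec ip s w n; pose u := uvec ip s w n.
(* [p j = 0] forces [v j = 0] but not [u j = 0]; cutting [u] off there makes
   [Top] its frame operator and changes neither [Gamma] nor [Gamma_hat]. *)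
pose u' j := if 0 < p j then u j else 0.
have vh : @vnorm R n = hnorm stdip by apply/funext => x; apply: vnormE.
have D0 : 0 < Db by case: Hw => C0 CD _; apply: lt_le_trans CD.
pose sD := Num.sqrt Db; have sD0 : 0 < sD by rewrite sqrtr_gt0.
have pE j : p j = 0 \/ 0 < p j.
  by have := Hp0 j; rewrite le_eqVlt => /predU1P[<-|]; [left|right].
have v0 j : p j = 0 -> v j = 0.
  by move=> pj; apply/eqP; apply: contraT => /HAiii; rewrite pj ltxx.
have Hv j : vnorm (v j) ^+ 2 <= Rr * p j.
  have [pj|pj] := pE j; first by rewrite pj v0// vnorm0 expr0n mulr0.
  rewrite -ler_pdivrMr//; apply: le_trans (_ : Rcst ip s w n p <= Rr); last first.
    by rewrite /Rr /Rcst'' le_max lexx.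
  apply: ub_le_sup; last by exists j.
  by have [M HM] := HAii; exists M => _ [k [pk ->]]; apply: HM.
have Hu j : hnorm ip (u' j) ^+ 2 <= Rr * p j.
  rewrite /u'; have [pj|pj] := pE j; first by rewrite pj ltxx (hnorm0 HI) expr0n mulr0.
  rewrite pj -ler_pdivrMr//; apply: le_trans (_ : Rcst' ip s w n p <= Rr); last first.
    by rewrite /Rr /Rcst'' le_max lexx orbT.
  apply: ub_le_sup; last by exists j.
  by have [M HM] := HAii'; exists M => _ [k [pk ->]]; apply: HM.
have SigT := Sigma_tends HI (w := w) (n := n) Bess; rewrite -/S vh -/v in SigT.
(* A nonzero [Sigma] forces some v_j to be nonzero, and with it the positivity of n, R'' and K. *)
have [x0 Sx0] : exists x : 'cV_n, S *m x != 0.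
  apply: contrapT => H; move/eqP: HSig; apply; apply: mulmx_ext => x.
  by apply/eqP; rewrite mul0mx; apply: contraT => Sx; exfalso; apply: H; exists x.
have [j0 vj0] : exists j, v j != 0.
  apply: contrapT => H; move/eqP: Sx0; apply.
  have vz j : v j = 0.
    by apply/eqP; apply: contraT => vj; exfalso; apply: H; exists j.
  apply: (hnorm_eq0 stdip_inner); apply/eqP; rewrite eq_le hnorm_ge0 andbT.
  apply: (tends_hnorm_le stdip_inner _ (SigT x0)) => N.
  by rewrite big1 ?(hnorm0 stdip_inner)// => j _; rewrite vz scaler0.
have vnorm_gt0 (x : 'cV[R[i]]_n) : x != 0 -> 0 < vnorm x.
  move=> xn; rewrite lt_def vnorm_ge0 andbT; apply: contra_neq xn => x00.
  by apply: (hnorm_eq0 stdip_inner); rewrite -vnormE.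
have Rr0 : 0 < Rr.
  have pj := HAiii _ vj0; have := Hv j0; rewrite -(pmulr_lgt0 _ pj).
  by apply: lt_le_trans; rewrite exprn_gt0// vnorm_gt0.
have n0 : (0 < n)%N.
  rewrite lt0n; apply/eqP => n00; move/eqP: vj0; apply; apply/colP => k.
  by have := ltn_ord k; rewrite {2}n00.
have SK : mxnorm S <= K by rewrite /K /Kcst le_max lexx.
have K0 : 0 < K.
  apply: lt_le_trans SK; rewrite lt_def mxnorm_ge0 andbT; apply/eqP => S00.
  by have := vnorm_mulmx S x0; rewrite S00 mul0r leNgt vnorm_gt0.
have [P1 PL] := partial_sums_cvg _ Hp0 Hp1.
have TopT x : tends (hnorm ip) (fun M => \sum_(j < M) ip x (u' j) *: u' j)
    (Top ip s w n p x).
  have Eq : (fun j => if 0 < p j then ip x (u j) *: u j else 0) =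
            (fun j => ip x (u' j) *: u' j).
    by apply/funext => j; rewrite /u'; case: ifP; rewrite ?scaler0.
  rewrite /Top -/u Eq.
  apply: (@hilbert_series_tends _ _ _ HI _ (fun j => hnorm ip x * (Rr * p j))
    (hnorm ip x * Rr)) => // [j|N].
    rewrite (hnormZ HI); apply: le_trans (ler_wpM2r (hnorm_ge0 _) (cabs_ip HI _ _)) _.
    by rewrite -mulrA ler_wpM2l ?hnorm_ge0// -expr2.
  rewrite -mulr_sumr ler_wpM2l ?hnorm_ge0// -mulr_sumr.
  by rewrite -[leRHS]mulr1 ler_wpM2l// ltW.
have sumle x (N : nat) (y : nat -> R) : (forall j, y j <= hnorm ip x * (Rr * p j)) ->
    hnorm ip x <= 1 -> \sum_(j < N) y j <= Rr.
  move=> Hy x1; apply: (@le_trans _ _ (\sum_(j < N) Rr * p j)).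
    apply: ler_sum => j _; apply: le_trans (Hy j) _.
    by rewrite ler_piMl// mulr_ge0// ltW.
  by rewrite -mulr_sumr -[leRHS]mulr1 ler_wpM2l// ltW.
have Topb x : hnorm ip x <= 1 -> hnorm ip (Top ip s w n p x) <= Rr.
  move=> x1; apply: (tends_hnorm_le HI _ (TopT x)) => N.
  apply: le_trans (hnorm_sum HI _ _ _ _) _; apply: (sumle x N (fun j => hnorm ip (ip x (u' j) *: u' j))) => // j.
  rewrite (hnormZ HI); apply: le_trans (ler_wpM2r (hnorm_ge0 _) (cabs_ip HI _ _)) _.
  by rewrite -mulrA ler_wpM2l ?hnorm_ge0// -expr2.
have Bu N x : \sum_(j < N) cnorm2 (ip x (u' j)) <= K * hnorm ip x ^+ 2.
  apply: (frame_operator_bessel HI _ TopT) => {}x x1.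
  apply: le_trans (_ : opnorm (hnorm ip) (hnorm ip) (Top ip s w n p) <= K).
    exact: le_opnorm Topb x1.
  by rewrite /K /Kcst le_max lexx orbT.
have Bvs N x : \sum_(j < N) cnorm2 (stdip x (v j)) <= K * hnorm stdip x ^+ 2.
  apply: (frame_operator_bessel stdip_inner _ SigT) => {}x x1.
  rewrite -vnormE in x1; rewrite -vnormE; apply: le_trans (vnorm_mulmx _ _) _.
  by apply: le_trans SK; rewrite ler_piMr ?mxnorm_ge0.
have Bv N (y : 'rV_n) : \sum_(j < N) cnorm2 ((y *m v j) 0 0) <= K * fro y.
  rewrite -fro_adj -sqr_vnorm vnormE; apply: le_trans (Bvs N _).
  apply: ler_sum => j _.
  by rewrite (ipC stdip_inner (v j)) cnorm2_conj stdipE adjK.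
have GamT x : tends (@vnorm R n) (fun N => \sum_(j < N) ip x (u' j) *: v j)
    (Gamma ip s w n x).
  have := Gamma_tends HI (w := w) (n := n) Bess x.
  rewrite [X in tends _ X](_ : _ = (fun N => \sum_(j < N) ip x (u' j) *: v j))//.
  apply/funext => N; apply: eq_bigr => j _; rewrite -/v /u'.
  by have [pj|->//] := pE j; rewrite v0// !scaler0.
have Gamb x : hnorm ip x <= 1 -> vnorm (Gamma ip s w n x) <= Rr.
  move=> x1; have := GamT x; rewrite vh => /(tends_hnorm_le stdip_inner); apply => N.
  apply: le_trans (hnorm_sum stdip_inner _ _ _ _) _; apply: (sumle x N (fun j => hnorm stdip (ip x (u' j) *: v j))) => // j.
  rewrite -vnormE vnormZ; apply: le_trans (ler_wpM2r (vnorm_ge0 _) (cabs_ip HI _ _)) _.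
  rewrite -mulrA ler_wpM2l ?hnorm_ge0//.
  rewrite -ler_sqr ?nnegrE ?mulr_ge0 ?hnorm_ge0 ?vnorm_ge0 ?(ltW Rr0)//.
  by rewrite exprMn expr2 ler_pM ?sqr_ge0// -expr2.
have hn01 : hnorm ip 0 <= 1 by rewrite (hnorm0 HI).
have g0 : 0 <= g by apply: le_trans (le_opnorm Gamb hn01); apply: vnorm_ge0.
have a0 : 0 <= a by apply: mxnorm_ge0.
have Lam0 : 0 < Lam by rewrite /Lam; clear -a0 g0; lra.
have LD0 : 0 < Lam * sD by rewrite mulr_gt0.
have e1 : eps < Lam * sD.
  apply: lt_le_trans Heps' _; rewrite -[leRHS]mulr1 ler_wpM2l ?(ltW LD0)//.
  by rewrite ge_min lexx.
have e2 : eps < Lam * sD * (2 * a).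
  apply: lt_le_trans Heps' _; rewrite ler_wpM2l ?(ltW LD0)//.
  by rewrite ge_min lexx orbT.
(* Read off from the upper bound on [eps], whose minimum contains 2 a. *)
have ap : 0 < a.
  by have := lt_trans Heps e2; rewrite pmulr_rgt0// pmulr_rgt0.
have SA : adj S = S := Sigma_adj (w := w) (n := n) Bess.
have pX : is_pinv S X := pinv_exists _ SA.
have aK : 1 <= a * K.
  have := vnorm_mulmx S (X *m (S *m x0)); have [SXS _ _ _] := pX.
  rewrite !mulmxA SXS => h1.
  have h2 : vnorm (X *m (S *m x0)) <= a * vnorm (S *m x0) := vnorm_mulmx X _.
  have y0 := vnorm_gt0 _ Sx0; rewrite -(ler_pM2r y0) mul1r; apply: le_trans h1 _.
  rewrite -mulmxA; apply: le_trans (ler_wpM2l (mxnorm_ge0 _) h2) _.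
  by rewrite mulrA ler_wpM2r ?(ltW y0)// [leRHS]mulrC ler_wpM2r.
have [eta1 eta1E] : exists t, t = eps / (Lam * sD) by eexists.
have [eta2 eta2E] : exists t, t = eps / (4 * a ^+ 2 * Lam * sD) by eexists.
have eta10 : 0 < eta1 by rewrite eta1E divr_gt0.
have eta11 : eta1 < 1 by rewrite eta1E ltr_pdivrMr// mul1r.
have eta1a : eta1 < 2 * a by rewrite eta1E ltr_pdivrMr// mulrC.
have eta2D : 4 * a ^+ 2 * eta2 = eta1.
  by rewrite eta1E eta2E; field; rewrite !gt_eqF.
have eta20 : 0 < eta2.
  by rewrite eta2E divr_gt0// !mulr_gt0// exprn_gt0.
have eta2a : 2 * a * eta2 < 1.
  rewrite -(ltr_pM2l (_ : 0 < 2 * a)) ?mulr_gt0// mulr1.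
  by rewrite (_ : 2 * a * (2 * a * eta2) = eta1)// -eta2D; ring.
pose eta := Num.min eta1 eta2.
have eta0 : 0 < eta by rewrite lt_min eta10.
have etale1 : eta <= eta1 by rewrite ge_min lexx.
have etale2 : eta <= eta2 by rewrite ge_min lexx orbT.
(* From eta1 < 2 a one gets a eta2 < 1/2, and a K >= 1 finishes. *)
have etaK : eta <= K / 2.
  apply: le_trans etale2 _; rewrite -(ler_pM2l ap); clear -aK eta2a; nra.
have Hm' : Mtilde K Rr n eta (delta / 2) <= m%:R.
  have : Num.max (Mtilde K Rr n eta1 (delta / 2)) (Mtilde K Rr n eta2 (delta / 2)) <= m%:R.
    by rewrite eta1E eta2E; exact: Hm.
  rewrite ge_max => /andP[m1 m2]; rewrite /eta /Num.min; by case: ifP.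
have dl0 : 0 < delta / 2 by rewrite divr_gt0.
have dl1 : delta / 2 < 1 by clear -Hdelta Hdelta'; lra.
have SigE x e : 0 < e -> exists M0, forall M, (M0 <= M)%N ->
    vnorm (\sum_(j < M) stdip x (v j) *: v j - S *m x) < e.
  by rewrite vh; apply: SigT.
have Hvs j : hnorm stdip (v j) ^+ 2 <= Rr * p j by rewrite -vnormE.
have [N1 C1] := concentration stdip_inner K0 Rr0 Hp0 Hp1 Hv Hvs Bv Bvs SigE
  dl0 dl1 n0 eta0 etaK Hm'.
have [N2 C2] := concentration HI K0 Rr0 Hp0 Hp1 Hv Hu Bv Bu GamT
  dl0 dl1 n0 eta0 etaK Hm'.
(* By Bernoulli's inequality the samples with an index at least N have mass at most m times the tail
   of [p], hence at most delta / 2. *)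
have dm0 : 0 < delta / (2 * m.+1%:R) by rewrite divr_gt0// mulr_gt0// ltr0n.
have [N3 C3] := PL _ dm0.
pose N := maxn N1 (maxn N2 N3).
have {}C1 := C1 N (leq_maxl _ _).
have {}C2 := C2 N (leq_trans (leq_maxl _ _) (leq_maxr _ _)).
have {}C3 := C3 N (leq_trans (leq_maxr _ _) (leq_maxr _ _)).
pose B1 (i : {ffun 'I_m -> 'I_N}) := `[< exists x, eta * hnorm stdip x <
  vnorm (sample_mean (ip := stdip) v v p (fun t => i t) x - S *m x) >].
pose B2 (i : {ffun 'I_m -> 'I_N}) := `[< exists x, eta * hnorm ip x <
  vnorm (sample_mean (ip := ip) v u' p (fun t => i t) x - Gamma ip s w n x) >].
have {}C1 : \sum_(i | B1 i) \prod_t p (i t) <= delta / 2 / 2 := C1.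
have {}C2 : \sum_(i | B2 i) \prod_t p (i t) <= delta / 2 / 2 := C2.
apply: le_trans (iid_prob_ge B1 B2 Hp0 _).
  rewrite lee_fin.
  have PN1 := P1 N; set PN := \sum_(j < N) p j in C3 PN1 *.
  have PN0 : 0 <= PN by apply: sumr_ge0.
  have bern : 1 - m%:R * (1 - PN) <= PN ^+ m.
    have := @bernoulli_le R (1 - PN) m; rewrite (_ : 1 - (1 - PN) = PN); last by ring.
    by apply; rewrite ?subr_ge0 ?gerBl.
  have : m%:R * (1 - PN) <= delta / 2.
    apply: (@le_trans _ _ (m%:R * (delta / (2 * m.+1%:R)))).
      by rewrite ler_wpM2l// lerBlDr addrC -lerBlDr.
    rewrite mulrA ler_pdivrMr ?mulr_gt0 ?ltr0n// -(natr1 m).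
    have md0 : 0 <= m%:R * delta by rewrite mulr_ge0// ltW.
    by clear -md0 Hdelta; lra.
  by move=> mP; clear -mP bern C1 C2; lra.
move=> i nB1 nB2; set i' := [ffun t => _] : {ffun 'I_m -> nat}.
have i'E : (fun t => i t : nat) = i' by apply/funext => t; rewrite ffunE.
set Sh := Sigma_hat ip s w n p i'; set Xh := mppinv Sh.
have ShE x : vnorm (Sh *m x - S *m x) <= eta * vnorm x.
  rewrite leNgt; apply: contra nB1 => H; apply/asboolP; exists x.
  by rewrite -vnormE i'E -(Sigma_hat_mul HI).
have GhE x : vnorm (Gamma_hat ip s w n p i' x - Gamma ip s w n x) <= eta * hnorm ip x.
  rewrite leNgt; apply: contra nB2 => H; apply/asboolP; exists x.
  rewrite i'E (_ : sample_mean v u' p i' x = Gamma_hat ip s w n p i' x)//.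
  rewrite (Gamma_hatE HI) /sample_mean; congr (_ *: _); apply: eq_bigr => t _.
  by rewrite /u'; have [->|->//] := pE (i' t); rewrite invr0 !mul0r.
have ShA : adj Sh = Sh by apply: Sigma_hat_adj.
have pXh : is_pinv Sh Xh := pinv_exists _ ShA.
have ran : S *m X *m Sh = Sh by apply: (Sigma_range_hat HI Bess).
have ShE' y : vnorm ((Sh - S) *m y) <= eta * vnorm y by rewrite mulmxBl.
have aeta : a * eta <= 1 / 2.
  by have ae := ler_wpM2l a0 etale2; clear -ae eta2a; lra.
have [_ XhE] := pinv_perturbation _ _ _ _ _ _ SA ShA pX pXh ran a0 (vnorm_mulmx X) ShE' aeta.
(* The 4 a^2 in the second threshold is made for this: 2 a^2 eta2 = eta1 / 2. *)
have XhE' y : vnorm (Xh *m y - X *m y) <= eta1 / 2 * vnorm y.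
  apply: le_trans (XhE y) _; rewrite ler_wpM2r ?vnorm_ge0// -eta2D.
  by have ae := ler_wpM2l (sqr_ge0 a) etale2; clear -ae; lra.
have WnD := Wn_bounded HI (n := n) (ltW D0) (frame_bessel HI Hw).
(* The three terms bound X (Gh - G), (Xh - X)(Gh - G) and (Xh - X) G. *)
pose d := sD * (eta1 * (a + eta1 / 2 + g / 2)).
have dlt : d < eps.
  have -> : eps = sD * (eta1 * Lam).
    by rewrite eta1E; field; rewrite !gt_eqF.
  by rewrite /d ltr_pM2l// ltr_pM2l// /Lam; clear -eta11 g0; lra.
apply: le_lt_trans dlt; rewrite /K_Omega /Ktrue -/S -/X -/Sh -/Xh.
apply: (opnorm_dist hn01 (M := sD * (a * Rr))) => z z1.
  apply: le_trans (WnD _) _; rewrite ler_wpM2l ?(ltW sD0)//.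
  by apply: le_trans (vnorm_mulmx _ _) _; rewrite ler_wpM2l// Gamb.
set Gh := Gamma_hat ip s w n p i' z; set G := Gamma ip s w n z.
apply: le_trans (hnorm_dist HI _ _) _; rewrite -WnB; apply: le_trans (WnD _) _.
rewrite ler_wpM2l ?(ltW sD0)//.
have -> : Xh *m Gh - X *m G = (Xh *m (Gh - G) - X *m (Gh - G)) + X *m (Gh - G)
    + (Xh *m G - X *m G).
  by rewrite subrK (mulmxBr Xh Gh G) addrA subrK.
have GG : vnorm (Gh - G) <= eta1.
  apply: le_trans (GhE z) _; apply: le_trans etale1.
  by rewrite ler_piMr// ltW.
have Gg : vnorm G <= g by apply: le_opnorm Gamb z1.
have h1 := XhE' (Gh - G); have h3 := XhE' G.
have h2 : vnorm (X *m (Gh - G)) <= a * vnorm (Gh - G) := vnorm_mulmx X _.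
have eta12 : 0 <= eta1 / 2 by rewrite divr_ge0// ltW.
have k1 := ler_wpM2l eta12 GG; have k2 := ler_wpM2l a0 GG; have k3 := ler_wpM2l eta12 Gg.
apply: le_trans (vnormD _ _) _.
have h4 := le_trans (vnormD _ _) (lerD (le_trans h1 k1) (le_trans h2 k2)).
apply: le_trans (lerD h4 (le_trans h3 k3)) _.
by clear; lra.
Qed.
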